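(* Let $\mathcal{S}$ be a divisorial fan on a smooth projective curve $Y$, $X=X(\mathcal{S})$, and let $D_h$ be the $T$-invariant Cartier divisor on $X$ given by $h\in\mathrm{CaSF}(\mathcal{S})$, with linear part $h_t$. Let $L(h)=\bigoplus_{u\in M}L(h)_u=\Gamma(X,\mathcal{O}(D_h))$ be the $M$-graded module of global sections. Then: (1) The weight set $\{u\in M\mid L(h)_u\neq0\}$ of $L(h)$ is a subset of $\Box_h$. (2) For $u\in\Box_h\cap M$ we have $L(h)_u=\Gamma(Y,\mathcal{O}(h^*(u)))$.
   Context: Ground field $\mathbb{K}$: algebraically closed of characteristic $0$. $N$ is a lattice of finite rank, $M=\mathrm{Hom}(N,\mathbb{Z})$, $N_{\mathbb{Q}}=N\otimes\mathbb{Q}$, $M_{\mathbb{Q}}=M\otimes\mathbb{Q}$, $T=\mathrm{Spec}\,\mathbb{K}[M]$. Let $\sigma\subset N_{\mathbb{Q}}$ be a pointed convex polyhedral cone. A polyhedron $\Delta$ has tailcone $\sigma$ if $\Delta=\pi+\sigma$ with $\pi$ a compact polyhedron; $\mathrm{Pol}^+_\sigma(N)$ is the semigroup under Minkowski addition of such polyhedra together with $\emptyset$. A polyhedral divisor on $Y$ with tailcone $\sigma=\mathrm{tail}\,\mathcal{D}$ is a formal sum $\mathcal{D}=\sum_{P\in Y}\Delta_P\otimes P$ with $\Delta_P\in\mathrm{Pol}^+_\sigma(N)$, only finitely many coefficients differing from $\sigma$. Its locus is $\mathrm{Loc}\,\mathcal{D}=Y\setminus\{P:\Delta_P=\emptyset\}$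 (affine or complete). For $u\in\sigma^\vee\cap M$ put $\mathcal{D}(u)=\sum_P\min_{v\in\Delta_P}\langle u,v\rangle P$ on $\mathrm{Loc}\,\mathcal{D}$. $\mathcal{D}$ is proper if $\mathcal{D}(u)$ is semiample for all $u\in\sigma^\vee\cap M$ and big for $u$ in the relative interior of $\sigma^\vee$. $X(\mathcal{D})=\mathrm{Spec}\bigoplus_{u\in\sigma^\vee\cap M}\Gamma(\mathrm{Loc}\,\mathcal{D},\mathcal{O}(\mathcal{D}(u)))$ with the $T$-action given by the grading. Semi-invariant rational functions are written uniquely as $f\chi^u$ with $f\in K(Y)$, $u\in M$, where $\chi^u$ is the unit of $K(Y)$ in degree $u$ of $\bigoplus_{u\in M}K(Y)$. Write $\mathcal{D}'\subset\mathcal{D}$ if $\Delta'_P\subset\Delta_P$ for all $P$; $\mathcal{D}'$ is a face of $\mathcal{D}$, $\mathcal{D}'\prec\mathcal{D}$, if the induced morphism $X(\mathcal{D}')\to X(\mathcal{D})$ is an open inclusion. $\mathcal{D}\cap\mathcal{D}'=\sum_P(\Delta_P\cap\Delta'_P)\otimes P$. A divisorial fan is a finite set $\mathcal{S}$ of proper polyhedral divisors with $\mathcal{D}\succ\mathcal{D}\cap\mathcal{D}'\prec\mathcal{D}'$ for all $\mathcal{D},\mathcal{D}'\in\mathcal{S}$; $X(\mathcal{S})$ is glued from the $X(\mathcal{D})$ along the $X(\mathcal{D}\cap\mathcal{D}')$. The slice $\mathcal{S}_P$ is the polyhedral complex defined by the $\Delta_P$, $\mathcal{D}\in\mathcal{S}$;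 $\mathrm{tail}\,\mathcal{S}$ is the fan of tailcones. Support functions. $\mathrm{SF}(\mathcal{S}_P)$: continuous functions $h_P:|\mathcal{S}_P|\to\mathbb{Q}$, affine on each polyhedron, with $k\,h_P(v)\in\mathbb{Z}$ whenever $k\in\mathbb{N}$ and $kv\in N$. The linear part of $h_P|_\Delta$ is $v\mapsto h_P(p+v)-h_P(p)$ on the tailcone of $\Delta$ ($p\in\Delta$). $\mathrm{SF}(\mathcal{S})$: collections $h=(h_P)_{P\in Y}\in\prod_P\mathrm{SF}(\mathcal{S}_P)$ with a common linear part $h_t$ on $|\mathrm{tail}\,\mathcal{S}|$ (polyhedra with the same tailcone, in any slices, give the same linear part) and $h_P=h_t$ for all but finitely many $P$. $h$ is principal if $h=\langle u,\cdot\rangle+D$ with $u\in M$ and $D$ a principal divisor on $Y$ (taken as the constant $\mathrm{coeff}_P(D)$ on $\mathcal{S}_P$); $h\in\mathrm{CaSF}(\mathcal{S})$ (Cartier) if $h|_{\mathcal{D}}$ is principal for each $\mathcal{D}\in\mathcal{S}$ with complete locus. The associated $T$-invariant Cartier divisor $D_h$ is given locally by $\mathrm{div}(f^{-1}\chi^{-u})$ wherever $h_P|_{\mathcal{D}}=\langle u,\cdot\rangle+\mathrm{ord}_P(f)$ for all $P$ in the relevant open subset of $\mathrm{Loc}\,\mathcal{D}$ (after restricting $\mathcal{D}$ with affine locus to sufficiently small open subsets of it); and $L(h)_u$ is identified with $\{f\in K(Y): f\chi^u\in\Gamma(X,\mathcal{O}(D_h))\}$. Definitions of $\Box_h$ and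 $h^*$: $\Box_h=\{u\in M_{\mathbb{Q}}\mid\langle u,v\rangle\ge h_t(v)\text{ for all }v\in|\mathrm{tail}\,\mathcal{S}|\}$, and $h^*(u)=\sum_P h_P^*(u)P$, where $h_P^*(u)$ is the minimal value of $u-h_P$ on the vertices of $\mathcal{S}_P$ (if $\mathcal{S}_P$ has no vertices, i.e. is empty, no condition is imposed at $P$, i.e. the coefficient is $+\infty$). For a $\mathbb{Q}$-divisor $E$, $\Gamma(Y,\mathcal{O}(E))=\{f\in K(Y):\mathrm{div}(f)+E\ge0\}\cup\{0\}$. *)

(* Defs.v *)
From HB Require Import structures.
From mathcomp Require Import all_boot all_order all_algebra.
From mathcomp Require Import boolp classical_sets functions cardinality.
From mathcomp Require Import constructive_ereal.
(* The notations of mpoly clash with those of classical_sets. *)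
From mathcomp Require Import -(notations) mpoly.

Set Implicit Arguments.
Unset Strict Implicit.
Unset Printing Implicit Defensive.

Import Order.TTheory GRing.Theory Num.Theory.

Local Open Scope classical_set_scope.
Local Open Scope ring_scope.

(** * Smooth projective curves over an algebraically closed field *)

(** Value at x of a form of degree d with coefficients mapped by iota. *)
Definition form_eval (K F : fieldType) (iota : {rmorphism K -> F}) (n d : nat)
    (x : 'I_n -> F) (G : dhomog n K d) : F :=
  mmap iota x G.

(** A projective variety V in P^n over K (integral closed subvariety), given
    with its function field K(V) and the homogeneous coordinates of its generic
    point: the homogeneous ideal of V consists of the forms G with
    G(pv_gen) = 0, and every rational function on V is a quotient of two forms
    of the same degree. *)
Record projVar (K : fieldType) := ProjVar {
  pv_dim : nat;
  pv_field : fieldType;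
  pv_iota : {rmorphism K -> pv_field};
  pv_gen : 'I_pv_dim.+1 -> pv_field;
  pv_gen_neq0 : exists i, pv_gen i != 0;
  pv_fractions : forall f : pv_field,
    exists d, exists A B : dhomog pv_dim.+1 K d,
      form_eval pv_iota pv_gen B != 0 /\
      f = form_eval pv_iota pv_gen A / form_eval pv_iota pv_gen B
}.

Definition alg_indep (K F : fieldType) (iota : {rmorphism K -> F})
    (k : nat) (a : 'I_k -> F) : Prop :=
  forall q : mpoly k K, mmap iota a q = 0 -> q = 0.

Definition trdeg_eq (K F : fieldType) (iota : {rmorphism K -> F}) (k : nat) :
    Prop :=
  (exists a : 'I_k -> F, alg_indep iota a) /\
  (forall a : 'I_k.+1 -> F, ~ alg_indep iota a).

Section ClosedPoints.
Variables (K : fieldType) (V : projVar K).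

Definition on_variety (p : {ffun 'I_(pv_dim V).+1 -> K}) : Prop :=
  forall d (G : dhomog (pv_dim V).+1 K d),
    form_eval (@pv_iota K V) (@pv_gen K V) G = 0 -> form_eval idfun p G = 0.

(** Closed points of P^n are represented by their unique homogeneous coordinate
    vector whose first nonzero entry is 1. *)
Definition normalized (p : {ffun 'I_(pv_dim V).+1 -> K}) : Prop :=
  exists i : 'I__, p i = 1 /\ forall j : 'I__, (j < i)%N -> p j = 0.

Definition closed_point : Type :=
  {p : {ffun 'I_(pv_dim V).+1 -> K} | normalized p /\ on_variety p}.

Definition local_ring (P : closed_point) : set (pv_field V) :=
  [set f | exists d, exists A B : dhomog (pv_dim V).+1 K d,
    form_eval idfun (sval P) B != 0 /\
    f = form_eval (@pv_iota K V) (@pv_gen K V) A /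
        form_eval (@pv_iota K V) (@pv_gen K V) B].

Definition max_ideal (P : closed_point) : set (pv_field V) :=
  [set f | exists d, exists A B : dhomog (pv_dim V).+1 K d,
    [/\ form_eval idfun (sval P) B != 0, form_eval idfun (sval P) A = 0 &
    f = form_eval (@pv_iota K V) (@pv_gen K V) A /
        form_eval (@pv_iota K V) (@pv_gen K V) B]].

Definition uniformizer (P : closed_point) (t : pv_field V) : Prop :=
  max_ideal P = [set t * a | a in local_ring P].

End ClosedPoints.

(** Smoothness of a variety of dimension 1: each local ring is regular, i.e.
    its maximal ideal is generated by dim = 1 element. *)
Record smoothProjCurve (K : fieldType) := SmoothProjCurve {
  curve_var :> projVar K;
  curve_dim1 : trdeg_eq (@pv_iota K curve_var) 1;
  curve_smooth : forall P : closed_point curve_var, exists t, uniformizer P t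
}.

(** * Divisors on a curve *)

Section Divisors.
Variables (K : fieldType) (Y : smoothProjCurve K).
Local Notation F := (pv_field Y).
Local Notation pt := (closed_point Y).

(** Order of vanishing at P of a nonzero rational function; ordP P 0 is a
    meaningless default. *)
Definition ordP (P : pt) (f : F) : int :=
  xget 0 [set k : int | exists t c : F,
    [/\ uniformizer P t, local_ring P c, local_ring P c^-1, c != 0 &
        f = t ^ k * c]].

(** Sections over U of O(E), where E is a Q-divisor whose coefficients may be
    +oo (no condition at such a point). *)
Definition Gamma (U : set pt) (E : pt -> \bar rat) : set F :=
  [set f | f = 0 \/
    forall P, U P -> (0 <= ((ordP P f)%:~R)%:E + E P)%E].

Definition is_semiample (U : set pt) (E : pt -> rat) : Prop :=
  exists2 n : nat, (0 < n)%N &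
    forall P, U P -> exists f : F,
      [/\ f != 0, Gamma U (fun Q => (n%:R * E Q)%:E) f &
          (ordP P f)%:~R + n%:R * E P = 0].

(** Iitaka dimension 1 = dim U: the sections of some multiple of E define a
    rational map with one-dimensional image. *)
Definition is_big (U : set pt) (E : pt -> rat) : Prop :=
  exists2 n : nat, (0 < n)%N & exists f g : F,
    [/\ Gamma U (fun Q => (n%:R * E Q)%:E) f,
        Gamma U (fun Q => (n%:R * E Q)%:E) g, g != 0 &
        ~ algebraicOver (@pv_iota K Y) (f / g)].

(** Nonempty open subsets of the curve are the cofinite ones. *)
Definition nonempty_open (U : set pt) : Prop := finite_set (~` U).

(** A nonempty open subset of a projective curve is complete if it is the whole
    curve, and affine otherwise. *)
Definition complete_locus (U : set pt) : Prop := U = setT.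

End Divisors.

(** * Polyhedra *)

(** N = Z^r and M = Hom(N, Z) = Z^r via the standard pairing, so N_Q and M_Q are
    both 'rV[rat]_r. *)
Section Polyhedra.
Variable r : nat.
Local Notation VQ := 'rV[rat]_r.

Definition toQ (w : 'rV[int]_r) : VQ := map_mx intr w.

Definition pairing (u v : VQ) : rat := \sum_i u 0 i * v 0 i.

Definition polyhedral_cone (sigma : set VQ) : Prop :=
  exists k (g : 'I_k -> VQ),
    sigma = [set v | exists2 c : 'I_k -> rat,
      (forall i, 0 <= c i) & v = \sum_i c i *: g i].

Definition pointed (sigma : set VQ) : Prop :=
  forall v, sigma v -> sigma (- v) -> v = 0.

Definition conv_hull k (g : 'I_k -> VQ) : set VQ :=
  [set v | exists c : 'I_k -> rat,
    [/\ forall i, 0 <= c i, \sum_i c i = 1 & v = \sum_i c i *: g i]].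

Definition has_tailcone (sigma Delta : set VQ) : Prop :=
  exists k (g : 'I_k.+1 -> VQ),
    Delta = [set a + b | a in conv_hull g & b in sigma].

Definition dual_cone (sigma : set VQ) : set VQ :=
  [set u | forall v, sigma v -> 0 <= pairing u v].

(** Interior of a convex cone C inside its linear span C - C. *)
Definition cone_relint (C : set VQ) : set VQ :=
  [set u | C u /\ exists2 e : rat, 0 < e &
    forall a b, C a -> C b -> (forall i, `|(a - b) 0 i| < e) ->
      C (u + (a - b))].

Definition is_vertex (Delta : set VQ) (v : VQ) : Prop :=
  Delta v /\ forall (a b : VQ) (t : rat), Delta a -> Delta b -> 0 < t < 1 ->
    v = t *: a + (1 - t) *: b -> a = v /\ b = v.

(** The minimum of A; a meaningless default if there is none. *)
Definition minval (A : set rat) : rat :=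
  xget 0 [set m | A m /\ forall x, A x -> m <= x].

End Polyhedra.

(** * Polyhedral divisors and the function field of the torus variety *)

Section PolyhedralDivisors.
Variables (K : fieldType) (Y : smoothProjCurve K) (r : nat).
Local Notation F := (pv_field Y).
Local Notation pt := (closed_point Y).
Local Notation VQ := 'rV[rat]_r.
Local Notation M := 'rV[int]_r.

Record polyDiv := PolyDiv { pd_tail : set VQ; pd_coef : pt -> set VQ }.

Definition Loc (D : polyDiv) : set pt := [set P | pd_coef D P !=set0].

Definition is_polyDiv (D : polyDiv) : Prop :=
  [/\ polyhedral_cone (pd_tail D), pointed (pd_tail D),
      forall P, pd_coef D P = set0 \/ has_tailcone (pd_tail D) (pd_coef D P) &
      finite_set [set P | pd_coef D P <> pd_tail D]].

Definition pdiv_eval (D : polyDiv) (u : VQ) (P : pt) : rat :=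
  minval [set pairing u v | v in pd_coef D P].

Definition proper_pdiv (D : polyDiv) : Prop :=
  forall u : M,
    (dual_cone (pd_tail D) (toQ u) ->
       is_semiample (Loc D) (pdiv_eval D (toQ u))) /\
    (cone_relint (dual_cone (pd_tail D)) (toQ u) ->
       is_big (Loc D) (pdiv_eval D (toQ u))).

(** K(X), the function field of X(D) for a proper D, is the fraction field of
    K(Y)[M]; the latter is the ring of Laurent polynomials in r variables. *)
Definition KX : fieldType := {fraction mpoly r F}.

Definition constX (f : F) : KX := FracField.tofrac (mpolyC r f).

Definition chi (u : M) : KX :=
  \prod_i (FracField.tofrac (mpolyX F (mnm1 i))) ^ (u 0 i).

(** The ring A with X(D) = Spec A, as a subring of K(X). *)
Definition ringX (D : polyDiv) : set KX :=
  [set phi | exists s : seq (M * F),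
    (forall p, p \in s -> dual_cone (pd_tail D) (toQ p.1) /\
       Gamma (Loc D) (fun P => (pdiv_eval D (toQ p.1) P)%:E) p.2) /\
    phi = \sum_(p <- s) constX p.2 * chi p.1].

End PolyhedralDivisors.

(** * Open inclusions of affine schemes *)

(** Spectra of subrings A `<=` B of a field. *)
Section Spec.
Variable L : fieldType.

Definition prime_of (A p : set L) : Prop :=
  [/\ p `<=` A, p 0, ~ p 1,
      (forall a b, p a -> p b -> p (a + b)) /\
      (forall a b, A a -> p b -> p (a * b)) &
      forall a b, A a -> A b -> p (a * b) -> p a \/ p b].

Definition localization (A p : set L) : set L :=
  [set x | exists a s, [/\ A a, A s, ~ p s & x = a / s]].

(** Spec B -> Spec A, q |-> q `&` A, is an open immersion: it is injective and
    open (it is always continuous), and an isomorphism on stalks (the stalk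
    maps being inclusions of subrings of L). *)
Definition open_immersion (A B : set L) : Prop :=
  [/\ forall q q', prime_of B q -> prime_of B q' ->
        q `&` A = q' `&` A -> q = q',
      forall I, I `<=` B -> exists2 J, J `<=` A &
        forall p, prime_of A p ->
          (~ J `<=` p <-> exists q, [/\ prime_of B q, ~ I `<=` q & q `&` A = p])
    & forall q, prime_of B q -> localization B q = localization A (q `&` A)].

End Spec.

(** * Divisorial fans, support functions, Cartier divisors *)

Section DivisorialFans.
Variables (K : fieldType) (Y : smoothProjCurve K) (r : nat).
Local Notation F := (pv_field Y).
Local Notation pt := (closed_point Y).
Local Notation VQ := 'rV[rat]_r.
Local Notation M := 'rV[int]_r.
Local Notation polyDiv := (polyDiv Y r).
Local Notation KX := (KX Y r).

Definition pdiv_sub (D' D : polyDiv) : Prop :=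
  forall P, pd_coef D' P `<=` pd_coef D P.

Definition is_face (D' D : polyDiv) : Prop :=
  pdiv_sub D' D /\ open_immersion (ringX D) (ringX D').

Definition pdiv_cap (D D' : polyDiv) : polyDiv :=
  PolyDiv (pd_tail D `&` pd_tail D') (fun P => pd_coef D P `&` pd_coef D' P).

Definition divisorial_fan (S : set polyDiv) : Prop :=
  [/\ finite_set S,
      forall D, S D -> is_polyDiv D /\ proper_pdiv D &
      forall D D', S D -> S D' ->
        is_face (pdiv_cap D D') D /\ is_face (pdiv_cap D D') D'].

Definition slice_support (S : set polyDiv) (P : pt) : set VQ :=
  [set v | exists2 D, S D & pd_coef D P v].

Definition slice_vertices (S : set polyDiv) (P : pt) : set VQ :=
  [set v | exists2 D, S D & is_vertex (pd_coef D P) v].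

Definition tail_support (S : set polyDiv) : set VQ :=
  [set v | exists2 D, S D & pd_tail D v].

Definition continuous_on (A : set VQ) (f : VQ -> rat) : Prop :=
  forall v, A v -> forall e : rat, 0 < e -> exists2 d : rat, 0 < d &
    forall w, A w -> (forall i, `|(w - v) 0 i| < d) -> `|f w - f v| < e.

Definition affine_on (A : set VQ) (f : VQ -> rat) : Prop :=
  exists (a : VQ) (c : rat), forall v, A v -> f v = pairing a v + c.

(** Only the values of hP on the support of the slice are relevant. *)
Definition SF_slice (S : set polyDiv) (P : pt) (hP : VQ -> rat) : Prop :=
  [/\ continuous_on (slice_support S P) hP,
      forall D, S D -> affine_on (pd_coef D P) hP &
      forall (k : nat) v, slice_support S P v ->
        (exists w : 'rV[int]_r, k%:R *: v = toQ w) ->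
        k%:R * hP v \is a Num.int].

(** h is a support function with linear part ht (which matters only on the
    support of the tail fan). *)
Definition SF (S : set polyDiv) (h : pt -> VQ -> rat) (ht : VQ -> rat) : Prop :=
  [/\ forall P, SF_slice S P (h P),
      forall P D p v, S D -> pd_coef D P p -> pd_tail D v ->
        h P (p + v) - h P p = ht v &
      finite_set [set P | ~ forall v, slice_support S P v -> h P v = ht v]].

(** h = <u, .> + div f over the open subset U of the locus of D. *)
Definition principal_on (D : polyDiv) (U : set pt) (h : pt -> VQ -> rat)
    (u : M) (f : F) : Prop :=
  f != 0 /\ forall P v, U P -> pd_coef D P v ->
    h P v = pairing (toQ u) v + (ordP P f)%:~R.

Definition CaSF (S : set polyDiv) (h : pt -> VQ -> rat) (ht : VQ -> rat) : Prop :=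
  SF S h ht /\
  forall D, S D -> complete_locus (Loc D) ->
    exists u f, principal_on D (Loc D) h u f.

Definition pdiv_restr (D : polyDiv) (U : set pt) : polyDiv :=
  PolyDiv (pd_tail D) (fun P => [set v | U P /\ pd_coef D P v]).

(** A Cartier divisor on X is given by an affine open cover of X, each member
    Spec A being recorded by A as a subring of K(X), together with a local
    equation e on each member; a section of O(E) on Spec A is a rational
    function phi with phi * e in A. *)
Definition cartier_data : Type := set (set KX * KX).

Definition sections (E : cartier_data) : set KX :=
  [set phi | forall A e, E (A, e) -> A (phi * e)].

(** D_h: if D has complete locus, h is principal on D itself; if D has affine
    locus, X(D) is covered by the X(D|_U) with U open in Loc D such that h is
    principal on D|_U. The local equation is f^-1 chi^(-u). *)
Definition cartier_of (S : set polyDiv) (h : pt -> VQ -> rat) : cartier_data :=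
  [set Ae | exists D U u f,
    [/\ S D, U `<=` Loc D /\ nonempty_open U,
        complete_locus (Loc D) -> U = Loc D,
        principal_on D U h u f &
        Ae = (ringX (pdiv_restr D U), (constX r f)^-1 * chi Y (- u))]].

Definition L_ (S : set polyDiv) (h : pt -> VQ -> rat) (u : M) : set F :=
  [set f | sections (cartier_of S h) (constX r f * chi Y u)].

Definition Box (S : set polyDiv) (ht : VQ -> rat) : set VQ :=
  [set u | forall v, tail_support S v -> ht v <= pairing u v].

Definition hstar (S : set polyDiv) (h : pt -> VQ -> rat) (u : VQ) (P : pt) :
    \bar rat :=
  if `[< slice_vertices S P !=set0 >] then
    (minval [set pairing u v - h P v | v in slice_vertices S P])%:E
  else +oo%E.

End DivisorialFans.

(* Main.v *)
Require Import Defs.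
From HB Require Import structures.
From mathcomp Require Import all_boot all_order all_algebra.
From mathcomp Require Import boolp classical_sets functions cardinality.
From mathcomp Require Import constructive_ereal.
From mathcomp Require Import -(notations) mpoly.
From mathcomp Require Import ring lra.

(** Let f be a nonzero rational function on Y.  On a chart X(D|_U) where h is
    trivialized as u' + ord f', the product of f chi^u with the local equation
    is (f / f') chi^(u - u').  The coordinate ring of the chart is graded, so
    this homogeneous element is regular if and only if u - u' lies in the dual
    of the tailcone of D and f / f' is a section of D(u - u') over U.  Since u'
    is the linear part of h, the first condition says that u >= h_t on the
    tailcone.  Since h_P = u' + ord_P f' on the coefficient of D at P, the second
    says that ord_P f + (u - h_P) >= 0 on that coefficient, for all P in U.
    Neither condition mentions the trivialization any more.  Hence f chi^u is a
    section of O(D_h) if and only if u lies in the polyhedron Box of h_t and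
    ord_P f + min (u - h_P) >= 0 at all points P, the minimum being taken over
    the slice at P: this is L_nonzero.  The first claim follows at once.  For u
    in Box, the function u - h_P is affine on each polyhedron of the slice with
    a nonnegative linear part, so it attains its minimum at a vertex, which
    turns the second condition into a condition on h^*: this is hstarE.

    The argument relies on four facts about the geometry behind it.

    - The order at a point is a discrete valuation, and a nonzero function has
      finitely many zeros and poles.  Both follow from transcendence degree 1
      through trdeg1_dvd: if a <> 0 and b are rational functions, some p(b) with
      p a nonzero polynomial is a multiple of a in K[a, b].  With b a uniformizer
      this says that a divides a power of it; with b a coordinate function, that
      b has finitely many values on the zeros of a.

    - A nonempty open set contains a closed point (nonempty_open_neq0);
      otherwise a chart could be empty and say nothing about h_t.  This is the
      Nullstellensatz, proved by extending homomorphisms to K from a ring A to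
      A[y], one homogeneous coordinate of the generic point at a time.

    - Every point of the locus has a neighborhood on which h is principal
      (locally_principal).  This needs u' and ord_P f' to be integral, which
      integral_affine derives from the integrality condition on h_P: the
      lattice points in the span of the cone over a polyhedron form a saturated
      lattice, so that integral forms on it extend.

    - The characters chi^u are linearly independent over K(Y)
      (chi_independent), so that the grading exists. *)

Set Implicit Arguments.
Unset Strict Implicit.
Unset Printing Implicit Defensive.

Import Order.TTheory GRing.Theory Num.Theory.

(** * Values of rational functions at closed points *)

Section Forms.
Variables (K : fieldType) (n : nat).
Local Open Scope ring_scope.

Lemma form_evalM d e (A : dhomog n K d) (B : dhomog n K e) :
  exists C : dhomog n K (d + e),
    forall (L : fieldType) (j : {rmorphism K -> L}) (y : 'I_n -> L),
      form_eval j y C = form_eval j y A * form_eval j y B.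
Proof.
exists (DHomog (dhomogM (valP A) (valP B))) => L j y.
by rewrite /form_eval /= rmorphM.
Qed.

Lemma form_evalD d (A B : dhomog n K d) :
  exists C : dhomog n K d,
    forall (L : fieldType) (j : {rmorphism K -> L}) (y : 'I_n -> L),
      form_eval j y C = form_eval j y A + form_eval j y B.
Proof.
exists (DHomog (dhomogD (valP A) (valP B))) => L j y.
by rewrite /form_eval /= rmorphD.
Qed.

Lemma form_evalC (a : K) :
  exists C : dhomog n K 0,
    forall (L : fieldType) (j : {rmorphism K -> L}) (y : 'I_n -> L),
      form_eval j y C = j a.
Proof.
have h1 : (a *: (1 : mpoly n K)) \is ishomog1 0 (mdeg) by apply/dhomogZ/dhomog1.
exists (DHomog h1) => L j y.
by rewrite /form_eval /= mmapZ rmorph1 mulr1.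
Qed.

Lemma form_evalX (i : 'I_n) :
  exists C : dhomog n K 1,
    forall (L : fieldType) (j : {rmorphism K -> L}) (y : 'I_n -> L),
      form_eval j y C = y i.
Proof.
have h1 : mpolyX K (mnm1 i) \is ishomog1 1 (mdeg).
  by rewrite dhomogX /= mdeg1.
exists (DHomog h1) => L j y.
by rewrite /form_eval /= mmapX mmap1U.
Qed.

Lemma form_evalXn d (i : 'I_n) :
  exists C : dhomog n K d,
    forall (L : fieldType) (j : {rmorphism K -> L}) (y : 'I_n -> L),
      form_eval j y C = y i ^+ d.
Proof.
have h1 : mpolyX K (mnm_muln (mnm1 i) d) \is ishomog1 d mdeg.
  by rewrite dhomogX /= mdegMn mdeg1 mul1n.
exists (DHomog h1) => L j y.
by rewrite /form_eval /= -mpolyXn rmorphXn /= mmapX mmap1U.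
Qed.

Lemma form_eval_scale (F : fieldType) (iota : {rmorphism K -> F}) d
    (x : 'I_n -> F) (c : F) (G : dhomog n K d) :
  form_eval iota (fun i => c * x i) G = c ^+ d * form_eval iota x G.
Proof.
rewrite /form_eval /mmap mulr_sumr big_seq [RHS]big_seq; apply: eq_bigr => m mG.
have/dhomogP/(_ _ mG) /= dm := valP G.
have -> : c ^+ d = c ^+ mdeg m by rewrite dm.
rewrite mulrCA; congr (_ * _); rewrite /mmap1 mdegE.
rewrite -prodrXr -big_split; apply: eq_bigr => i _ /=.
by rewrite exprMn.
Qed.

End Forms.

Section Values.
Variables (K : fieldType) (V : projVar K).
Local Open Scope ring_scope.
Local Notation F := (pv_field V).
Local Notation iota := (@pv_iota K V).
Local Notation gen := (@pv_gen K V).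
Local Notation form := (dhomog (pv_dim V).+1 K).
Implicit Type P : closed_point V.

(** A closed point P is a place of K(V): the graph of the residue map
    from the local ring at P to K.  Working with the graph spares the choice of
    a representation of f as a quotient of forms. *)
Definition has_value P (f : F) (c : K) : Prop :=
  exists d (A B : form d), [/\ form_eval idfun (sval P) B != 0,
    f = form_eval iota gen A / form_eval iota gen B &
    c = form_eval idfun (sval P) A / form_eval idfun (sval P) B].

Lemma form_point_gen P d (B : form d) :
  form_eval idfun (sval P) B != 0 -> form_eval iota gen B != 0.
Proof.
by apply: contra_neq; case: (svalP P) => _; apply.
Qed.

Lemma local_ring_has_value P f : local_ring P f <-> exists c, has_value P f c.
Proof.
split=> [[d [A [B [B0 ->]]]]|[c [d [A [B [B0 -> _]]]]]]; last by exists d, A, B.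
by eexists; exists d, A, B.
Qed.

Lemma max_ideal_has_value P f : max_ideal P f <-> has_value P f 0.
Proof.
split=> [[d [A [B [B0 A0 ->]]]]|[d [A [B [B0 -> eA]]]]]; exists d, A, B.
  by split; rewrite // A0 mul0r.
split=> //; move/esym/eqP: eA.
by rewrite mulf_eq0 invr_eq0 (negPf B0) orbF => /eqP.
Qed.

Lemma has_valueC P c : has_value P (iota c) c.
Proof.
have [A Ae] := @form_evalC K (pv_dim V).+1 c.
have [B Be] := @form_evalC K (pv_dim V).+1 1.
exists 0%N, A, B; split; rewrite ?Ae ?Be ?rmorph1 ?invr1 ?mulr1 //.
by rewrite oner_eq0.
Qed.

Lemma has_valueM P f g c e : has_value P f c -> has_value P g e ->
  has_value P (f * g) (c * e).
Proof.
move=> [d1 [A1 [B1 [n1 -> ->]]]] [d2 [A2 [B2 [n2 -> ->]]]].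
have [A Ae] := form_evalM A1 A2; have [B Be] := form_evalM B1 B2.
exists (d1 + d2)%N, A, B; rewrite !Ae !Be mulf_neq0 //.
by split=> //; rewrite mulf_div.
Qed.

Lemma has_valueD P f g c e : has_value P f c -> has_value P g e ->
  has_value P (f + g) (c + e).
Proof.
move=> [d1 [A1 [B1 [n1 -> ->]]]] [d2 [A2 [B2 [n2 -> ->]]]].
have [C1 C1e] := form_evalM A1 B2; have [C2 C2e] := form_evalM B1 A2.
have [A Ae] := form_evalD C1 C2; have [B Be] := form_evalM B1 B2.
exists (d1 + d2)%N, A, B; rewrite !Ae !Be !C1e !C2e mulf_neq0 //.
have [m1 m2] := (form_point_gen n1, form_point_gen n2).
by split=> //; rewrite addf_div //; congr ((_ + _) / _); rewrite mulrC.
Qed.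

Lemma has_value_fun P f c e : has_value P f c -> has_value P f e -> c = e.
Proof.
suff h0 k : has_value P 0 k -> k = 0.
  move=> fc fe; apply/eqP; rewrite -subr_eq0; apply/eqP/h0.
  have -> : 0 = f + iota (-1) * f by rewrite rmorphN1 mulN1r subrr.
  by rewrite -[- e]mulN1r; apply/has_valueD/has_valueM/fe/has_valueC.
move=> [d [A [B [B0 /esym/eqP + ->]]]].
rewrite mulf_eq0 invr_eq0 (negPf (form_point_gen B0)) orbF => /eqP A0.
by case: (svalP P) => _ /(_ d A A0) ->; rewrite mul0r.
Qed.

Lemma has_valueV P f c : c != 0 -> has_value P f c -> has_value P f^-1 c^-1.
Proof.
move=> c0 [d [A [B [B0 -> ec]]]]; exists d, B, A.
rewrite ec !invf_div; split=> //.
by apply: contra_neq c0 => A0; rewrite ec A0 mul0r.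
Qed.

Lemma has_value_neq0 P f c : c != 0 -> has_value P f c -> f != 0.
Proof.
move=> c0 fc; apply: contra_neq c0 => f0; rewrite f0 in fc.
by apply: has_value_fun fc _; rewrite -[0 in X in has_value _ X _](rmorph0 iota);
  apply: has_valueC.
Qed.

Lemma has_valueX P f c n : has_value P f c -> has_value P (f ^+ n) (c ^+ n).
Proof.
move=> fc; elim: n => [|n IHn]; last by rewrite !exprS; apply: has_valueM.
by rewrite !expr0 -[1 in X in has_value _ X _](rmorph1 iota); apply: has_valueC.
Qed.

Lemma has_value_horner P f c (q : {poly K}) : has_value P f c ->
  has_value P (map_poly iota q).[f] q.[c].
Proof.
move=> fc; elim/poly_ind: q => [|q a IHq].
  by rewrite rmorph0 !horner0 -[0 in X in has_value _ X _](rmorph0 iota);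
    apply: has_valueC.
rewrite rmorphD rmorphM /= map_polyX map_polyC !hornerMXaddC.
by apply: has_valueD; [apply: has_valueM|apply: has_valueC].
Qed.

Lemma has_value_coord P i j (P0 : sval P j != 0) :
  has_value P (gen i / gen j) (sval P i / sval P j).
Proof.
have [A Ae] := form_evalX K i; have [B Be] := form_evalX K j.
by exists 1%N, A, B; rewrite !Ae !Be.
Qed.

End Values.

(** * Algebraic dependence on a curve *)

Section TrdegOne.
Variables (K F : fieldType) (iota : {rmorphism K -> F}).
Local Open Scope ring_scope.

(** The outer variable of Q takes the value a, so that dividing a relation by a
    means dividing Q by 'X. *)
Definition eval2 (a b : F) (Q : {poly {poly K}}) : F :=
  (map_poly (horner_eval b \o map_poly iota) Q).[a].

Lemma eval2_is_zmod_morphism a b : zmod_morphism (eval2 a b).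
Proof. by move=> p q; rewrite /eval2 rmorphB hornerD hornerN. Qed.

Lemma eval2_is_monoid_morphism a b : monoid_morphism (eval2 a b).
Proof.
by split=> [|p q]; rewrite /eval2 ?rmorph1 ?hornerC // rmorphM hornerM.
Qed.

HB.instance Definition _ a b :=
  GRing.isZmodMorphism.Build {poly {poly K}} F (eval2 a b)
    (eval2_is_zmod_morphism a b).
HB.instance Definition _ a b :=
  GRing.isMonoidMorphism.Build {poly {poly K}} F (eval2 a b)
    (eval2_is_monoid_morphism a b).

Lemma eval2X a b : eval2 a b 'X = a.
Proof. by rewrite /eval2 map_polyX hornerX. Qed.

Lemma eval2C a b p : eval2 a b p%:P = (map_poly iota p).[b].
Proof. by rewrite /eval2 map_polyC hornerC. Qed.

Lemma trdeg1_eval2 (a b : F) : trdeg_eq iota 1 ->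
  exists2 Q : {poly {poly K}}, Q != 0 & eval2 a b Q = 0.
Proof.
case=> _ /(_ (fun i : 'I_2 => if i == ord0 then a else b)).
move=> /existsNP [q] /not_implyP [qab /eqP q0].
pose w (i : 'I_2) : {poly {poly K}} := if i == ord0 then 'X else 'X%:P.
pose Q := \sum_(m <- msupp q) (mcoeff m q)%:P%:P * mmap1 w m.
exists Q; last first.
  rewrite -[RHS]qab /Q /mmap rmorph_sum; apply: eq_bigr => m _.
  rewrite rmorphM /= eval2C map_polyC hornerC; congr (_ * _).
  rewrite /mmap1 rmorph_prod; apply: eq_bigr => i _.
  rewrite rmorphXn /w; case: ifP => _ /=; first by rewrite eval2X.
  by rewrite eval2C map_polyX hornerX.
pose m0 := mlead q.
have cQ : Q`_(m0 ord0)`_(m0 ord_max) = mcoeff m0 q.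
  rewrite /Q coef_sum coef_sum (bigD1_seq m0) ?msupp_uniq ?mlead_supp //=.
  have cw m : ((mcoeff m q)%:P%:P * mmap1 w m)`_(m0 ord0)`_(m0 ord_max)
     = mcoeff m q *+ (m0 == m).
    rewrite /mmap1 !big_ord_recl big_ord0 mulr1 /w /=.
    have -> : (lift ord0 ord0 : 'I_2) = ord_max by apply: val_inj.
    rewrite -rmorphXn mulrCA -rmorphM /= coefMC coefXn.
    rewrite mulr_natl coefMn coefCM coefXn -mulrnAr -mulrnA mulnb mulr_natr.
    congr (_ *+ nat_of_bool _).
    apply/idP/eqP => [/andP [/eqP e1 /eqP e0]|->]; last by rewrite !eqxx.
    apply/mnmP => i; case: (unliftP ord0 i) => [j ->|-> //].
    by have -> : lift ord0 j = ord_max :> 'I_2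
      by apply: val_inj; rewrite /= /bump; case: j => [[]].
  rewrite cw eqxx big1 ?addr0 // => m m0m; rewrite cw eq_sym.
  by rewrite (negPf m0m).
apply/eqP => Q0; move: cQ; rewrite Q0 !coef0 => /esym/eqP.
by rewrite mcoeff_eq0 mlead_supp.
Qed.

(** An algebraic relation between a and b may be divided by a as long as all its
    terms are multiples of a; afterwards p is its part free of a. *)
Lemma trdeg1_dvd (a b : F) : trdeg_eq iota 1 -> a != 0 ->
  exists p : {poly K}, exists2 Q : {poly {poly K}},
    p != 0 & (map_poly iota p).[b] = a * eval2 a b Q.
Proof.
move=> td a0; have [Q] := trdeg1_eval2 a b td.
elim/poly_ind: Q => [|Q p IHQ]; first by rewrite eqxx.
have [-> Q0|p0 _] := eqVneq p 0; last first.
  rewrite rmorphD rmorphM /= eval2X eval2C => e.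
  exists p, (- Q) => //; rewrite rmorphN mulrN.
  by apply/eqP; rewrite -addr_eq0 addrC mulrC e.
rewrite addr0 rmorphM /= eval2X => /eqP.
rewrite mulf_eq0 (negPf a0) orbF => /eqP; apply: IHQ.
by apply: contra_neq Q0 => ->; rewrite mul0r add0r.
Qed.

End TrdegOne.

Section TrdegOneValues.
Variables (K : fieldType) (V : projVar K).
Local Open Scope ring_scope.

Lemma has_value_eval2 (P : closed_point V) a b c e (Q : {poly {poly K}}) :
  has_value P a c -> has_value P b e ->
  exists k, has_value P (eval2 (@pv_iota K V) a b Q) k.
Proof.
move=> ac be; elim/poly_ind: Q => [|Q q [k IHQ]].
  by exists 0; rewrite rmorph0 -(rmorph0 (@pv_iota K V)); apply: has_valueC.
rewrite rmorphD rmorphM /= eval2X eval2C.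
by eexists; apply/has_valueD/has_value_horner/be/has_valueM/ac/IHQ.
Qed.

End TrdegOneValues.

(** * The order of a rational function at a point *)

Section Naturality.
Local Open Scope ring_scope.

Lemma rmorph_mmap n (K : fieldType) (R S : comNzRingType)
    (g : {rmorphism R -> S}) (f : {rmorphism K -> R}) (x : 'I_n -> R)
    (q : mpoly n K) :
  g (mmap f x q) = mmap (g \o f) (g \o x) q.
Proof.
rewrite /mmap rmorph_sum; apply: eq_bigr => m _; rewrite rmorphM /=.
congr (_ * _); rewrite /mmap1 rmorph_prod; apply: eq_bigr => i _.
by rewrite rmorphXn.
Qed.

End Naturality.

Section Order.
Variables (K : fieldType) (Y : smoothProjCurve K).
Local Open Scope ring_scope.
Local Notation F := (pv_field Y).
Local Notation iota := (@pv_iota K Y).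
Local Notation gen := (@pv_gen K Y).
Implicit Type P : closed_point Y.

Definition unit_at P (f : F) : Prop := exists2 c, c != 0 & has_value P f c.

Lemma unit_atM P f g : unit_at P f -> unit_at P g -> unit_at P (f * g).
Proof.
move=> [c c0 fc] [e e0 ge].
by exists (c * e); [rewrite mulf_neq0|apply: has_valueM].
Qed.

Lemma unit_atV P f : unit_at P f -> unit_at P f^-1.
Proof.
by move=> [c c0 fc]; exists c^-1; [rewrite invr_eq0|apply: has_valueV].
Qed.

Lemma unit_atXz P f (k : int) : unit_at P f -> unit_at P (f ^ k).
Proof.
move=> [c c0 fc].
have uX n : unit_at P (f ^+ n).
  by exists (c ^+ n); [rewrite expf_neq0|apply: has_valueX].
by case: k => n; [apply: uX|apply/unit_atV/uX].
Qed.

Lemma unit_at_neq0 P f : unit_at P f -> f != 0.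
Proof. by case=> c c0 /(has_value_neq0 c0). Qed.

Lemma unit_at1 P : unit_at P 1.
Proof. by exists 1; rewrite ?oner_eq0 // -(rmorph1 iota); apply: has_valueC. Qed.

Lemma unit_at_nvanish P f : unit_at P f -> ~ has_value P f 0.
Proof. by move=> [c c0 fc] /(has_value_fun fc) ce; rewrite ce eqxx in c0. Qed.

Lemma unit_at_local P f :
  unit_at P f <-> [/\ local_ring P f, local_ring P f^-1 & f != 0].
Proof.
split=> [uf|[/local_ring_has_value [c fc] /local_ring_has_value [e fe] f0]].
  have [c c0 fc] := uf; have [e e0 fe] := unit_atV uf.
  by split; [apply/local_ring_has_value; exists c
    |apply/local_ring_has_value; exists e|apply: unit_at_neq0 uf].
exists c => //; apply/eqP => c0; have := has_valueM fc fe.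
by rewrite c0 mul0r divff // => /(unit_at_nvanish (unit_at1 P)).
Qed.

Lemma point_coord P : exists i, sval P i != 0.
Proof.
by have [[i [Pi _]] _] := svalP P; exists i; rewrite Pi oner_eq0.
Qed.

(** A point at which no nonzero function vanishes would be the generic
    point, and K(Y) would be K. *)
Lemma exists_vanishing P : exists2 f : F, f != 0 & has_value P f 0.
Proof.
have [j Pj] := point_coord P.
apply: contrapT => nof.
have gj : gen j != 0.
  have [B Be] := @form_evalX K (pv_dim Y).+1 j.
  by rewrite -(Be _ iota); apply: (@form_point_gen _ _ P); rewrite Be.
have gi i : gen i = gen j * iota (sval P i / sval P j).
  have [h|h] := eqVneq (gen i / gen j - iota (sval P i / sval P j)) 0.
    by move/eqP: h; rewrite subr_eq0 => /eqP <-; rewrite mulrC divfK.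
  case: nof; exists (gen i / gen j - iota (sval P i / sval P j)) => //.
  rewrite -[X in has_value _ _ X](subrr (sval P i / sval P j)) -rmorphN.
  by apply: has_valueD; [apply: has_value_coord|apply: has_valueC].
have const f : exists c, f = iota c.
  have [d [A [B [B0 ->]]]] := pv_fractions f.
  have ev (G : dhomog (pv_dim Y).+1 K d) : form_eval iota gen G =
     gen j ^+ d * iota (form_eval idfun (fun i => sval P i / sval P j) G).
    rewrite [in LHS](funext gi) form_eval_scale; congr (_ * _).
    by rewrite /form_eval rmorph_mmap.
  rewrite !ev -mulf_div divff ?expf_neq0 // mul1r -fmorph_div.
  by eexists.
have [[a ind] _] := curve_dim1 Y.
have [c ac] := const (a ord0).
have := ind (mpolyX K (mnm1 ord0) - mpolyC 1 c).
rewrite rmorphB /= mmapX mmap1U mmapC ac subrr => /(_ erefl).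
move/(congr1 (mcoeff (mnm1 ord0))).
rewrite raddfB /= mcoeffX mcoeffC eqxx mnm1_eq0 mulr0 subr0 mcoeff0.
by move/eqP; rewrite oner_eq0.
Qed.

Lemma uniformizer_value P t : uniformizer P t -> has_value P t 0.
Proof.
move=> tu; apply/max_ideal_has_value; rewrite tu; exists 1; rewrite ?mulr1 //.
by apply/local_ring_has_value; exists 1; rewrite -(rmorph1 iota);
  apply: has_valueC.
Qed.

Lemma uniformizer_dvd P t f : uniformizer P t -> has_value P f 0 ->
  exists g, f = t * g /\ exists c, has_value P g c.
Proof.
move=> tu /max_ideal_has_value; rewrite tu => -[g /local_ring_has_value gc <-].
by exists g.
Qed.

Lemma uniformizer_neq0 P t : uniformizer P t -> t != 0.
Proof.
move=> tu; have [f f0 /(uniformizer_dvd tu) [g [fE _]]] := exists_vanishing P.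
by apply: contra_neq f0 => t0; rewrite fE t0 mul0r.
Qed.

(** The relation p(t) = f r between f and t, with p = X^m q and q(0) <> 0, shows
    that f divides t^m in the local ring; so a factor t can be split off f at
    most m times, and what remains is a unit. *)
Lemma uniformizer_decomp_local P t f c : uniformizer P t -> f != 0 ->
  has_value P f c -> exists n u, unit_at P u /\ f = t ^+ n * u.
Proof.
move=> tu f0 fc; have t0 := uniformizer_value tu; have tn0 := uniformizer_neq0 tu.
have [p [Q p0 pQ]] := trdeg1_dvd t (curve_dim1 Y) f0.
have [m [q + pE]] := multiplicity_XsubC p 0; rewrite p0 /= => q0.
rewrite subr0 in pE.
have uq : unit_at P (map_poly iota q).[t].
  by exists q.[0]; [rewrite -rootE|apply: has_value_horner].
have [s tms [e se]] : exists2 s, t ^+ m = f * s & exists e, has_value P s e.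
  have [e Qe] := has_value_eval2 Q fc t0.
  have [d d0 Vd] := unit_atV uq.
  exists (eval2 iota f t Q / (map_poly iota q).[t]).
    rewrite mulrA -pQ pE rmorphM /= map_polyXn hornerM hornerXn mulrAC.
    by rewrite divff ?mul1r // (unit_at_neq0 uq).
  by exists (e * d); apply: has_valueM.
elim: m f s c e f0 fc se tms {pE p pQ Q p0} => [|m IHm] f s c e f0 fc se.
  rewrite expr0 => fs; exists 0%N, f; rewrite mul1r; split=> //.
  exists c => //; apply/eqP => c0; have := has_valueM fc se.
  by rewrite -fs c0 mul0r => /(unit_at_nvanish (unit_at1 P)).
have [c0|c0] := eqVneq c 0; last first.
  by move=> _; exists 0%N, f; rewrite mul1r; split=> //; exists c.
rewrite c0 in fc; have [g [fE [k gk]]] := uniformizer_dvd tu fc.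
rewrite fE exprS -mulrA => /(mulfI tn0) tg.
have g0 : g != 0 by apply: contra_neq f0 => g0; rewrite fE g0 mulr0.
have [n [u [uu gE]]] := IHm g s k e g0 gk se tg.
by exists n.+1, u; rewrite exprS -mulrA -gE.
Qed.

Lemma uniformizer_decomp P t f : uniformizer P t -> f != 0 ->
  exists (k : int) u, unit_at P u /\ f = t ^ k * u.
Proof.
move=> tu f0; have [j Pj] := point_coord P.
have [d [A [B [B0 fE]]]] := pv_fractions f.
have [X Xe] := @form_evalX K (pv_dim Y).+1 j.
have gj : gen j != 0.
  by rewrite -(Xe _ iota); apply: (@form_point_gen _ _ P); rewrite Xe.
have loc (G : dhomog (pv_dim Y).+1 K d) : form_eval iota gen G != 0 ->
    exists n u, unit_at P u /\ form_eval iota gen G / gen j ^+ d = t ^+ n * u.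
  move=> G0; apply: (@uniformizer_decomp_local _ _ _
    (form_eval idfun (sval P) G / sval P j ^+ d)) => //.
    by rewrite mulf_neq0 // invr_eq0 expf_neq0.
  have [C Ce] := form_evalXn K d j.
  exists d, G, C; rewrite !Ce; split=> //.
  by rewrite expf_neq0.
have A0 : form_eval iota gen A != 0.
  by apply: contra_neq f0 => A0; rewrite fE A0 mul0r.
have [n [u [uu Au]]] := loc A A0; have [m [v [uv Bv]]] := loc B B0.
exists (n%:Z - m%:Z), (u / v); split; first exact/unit_atM/unit_atV.
rewrite fE; transitivity ((t ^+ n * u) / (t ^+ m * v)).
  by rewrite -Au -Bv invf_div mulrA divfK // expf_neq0.
rewrite expfzDr ?(uniformizer_neq0 tu) // -mulf_div; congr (_ * _ * _).
by rewrite exprnN.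
Qed.

Lemma uniformizer_exp_unit P t n : uniformizer P t -> unit_at P (t ^+ n) ->
  n = 0%N.
Proof.
move=> tu; case: n => // n /unit_at_nvanish; case.
have := has_valueX n.+1 (uniformizer_value tu).
by rewrite [0 ^+ _]exprS mul0r.
Qed.

Lemma uniformizer_exp_unitz P t (k : int) : uniformizer P t ->
  unit_at P (t ^ k) -> k = 0.
Proof.
move=> tu; case: k => n tk; first by rewrite (uniformizer_exp_unit tu tk).
have := unit_atV tk; rewrite NegzE -invr_expz invrK => {}tk.
by have := uniformizer_exp_unit tu tk.
Qed.

(** The order does not depend on the uniformizer, since any two uniformizers
    differ by a unit, and no nonzero power of a uniformizer is a unit. *)
Lemma ordP_eq P t f (k : int) : uniformizer P t -> unit_at P (f / t ^ k) ->
  ordP P f = k.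
Proof.
move=> tu uf; have t0 := uniformizer_neq0 tu.
have tk0 := expfz_neq0 k t0.
rewrite /ordP; case: xgetP => [l _ [s [c [su cl ciu cn0 fE]]]|/(_ k) []].
  have uc : unit_at P c by apply/unit_at_local.
  have s0 := uniformizer_neq0 su.
  have [a [sE [x ax]]] := uniformizer_dvd tu (uniformizer_value su).
  have [b [tE [y bz]]] := uniformizer_dvd su (uniformizer_value tu).
  have ab : a * b = 1.
    by apply: (mulfI t0); rewrite mulrA -sE -tE mulr1.
  have ua : unit_at P a.
    exists x => //; apply/eqP => x0; have := has_valueM ax bz.
    by rewrite ab x0 mul0r => /(unit_at_nvanish (unit_at1 P)).
  apply/eqP; rewrite -subr_eq0; apply/eqP/(uniformizer_exp_unitz tu).
  have -> : t ^ (l - k) = f / t ^ k / (a ^ l * c).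
    rewrite fE sE expfzMl expfzDr // -invr_expz.
    have a0 := unit_at_neq0 ua; have al0 := expfz_neq0 l a0.
    rewrite -[t ^ l * _ * c]mulrA [RHS]mulrAC mulfK //.
    by rewrite mulf_neq0.
  by apply/unit_atM/unit_atV/unit_atM => //; apply: unit_atXz.
exists t, (f / t ^ k); have [h1 h2 h3] := (unit_at_local P _).1 uf.
by split=> //; rewrite mulrC divfK.
Qed.

Lemma ordP_decomp P t f : uniformizer P t -> f != 0 ->
  unit_at P (f / t ^ ordP P f).
Proof.
move=> tu f0; have [k [u [uu fE]]] := uniformizer_decomp tu f0.
suff uk : unit_at P (f / t ^ k) by rewrite (ordP_eq tu uk).
by rewrite fE mulrC mulKf // expfz_neq0 // (uniformizer_neq0 tu).
Qed.

Lemma ordP_unit P f : unit_at P f -> ordP P f = 0.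
Proof.
by move=> uf; have [t tu] := curve_smooth P; apply: (ordP_eq tu); rewrite divr1.
Qed.

Lemma ordPM P f g : f != 0 -> g != 0 -> ordP P (f * g) = ordP P f + ordP P g.
Proof.
move=> f0 g0; have [t tu] := curve_smooth P; apply: (ordP_eq tu).
rewrite expfzDr ?(uniformizer_neq0 tu) // -mulf_div.
by apply: unit_atM; apply: ordP_decomp.
Qed.

Lemma ordPV P f : f != 0 -> ordP P f^-1 = - ordP P f.
Proof.
move=> f0; apply/eqP; rewrite -addr_eq0 addrC; apply/eqP.
have := @ordPM P f f^-1 f0; rewrite invr_eq0 divff // => /(_ f0) <-.
exact: ordP_unit (unit_at1 P).
Qed.

Lemma ordP_uniformizerXz P t (k : int) : uniformizer P t -> ordP P (t ^ k) = k.
Proof.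
move=> tu; apply: (ordP_eq tu).
by rewrite divff ?expfz_neq0 ?(uniformizer_neq0 tu) //; apply: unit_at1.
Qed.

Lemma ordP_ge0 P f c : f != 0 -> has_value P f c -> 0 <= ordP P f.
Proof.
move=> f0 fc; have [t tu] := curve_smooth P.
have [n [u [uu fE]]] := uniformizer_decomp_local tu f0 fc.
rewrite (@ordP_eq P t f n%:Z tu) // fE mulrC mulKf // expf_neq0 //.
exact: uniformizer_neq0 tu.
Qed.

Lemma ordPD P f g (k : int) : f != 0 -> g != 0 -> f + g != 0 ->
  k <= ordP P f -> k <= ordP P g -> k <= ordP P (f + g).
Proof.
move=> f0 g0 fg0 kf kg; have [t tu] := curve_smooth P.
have t0 := uniformizer_neq0 tu.
have val h : h != 0 -> k <= ordP P h -> exists c, has_value P (h / t ^ k) c.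
  move=> h0 kh; have [c c0 hc] := ordP_decomp tu h0.
  case nE: (ordP P h - k) (subr_ge0 k (ordP P h)) => [n|n]; last by rewrite kh.
  move=> _; exists (0 ^+ n * c).
  have -> : h / t ^ k = t ^+ n * (h / t ^ ordP P h).
    rewrite -[t ^+ n]/(t ^ n%:Z) -nE expfzDr // [RHS]mulrC -[RHS]mulrA.
    rewrite mulKf ?expfz_neq0 //.
    by rewrite -invr_expz.
  exact/has_valueM/hc/has_valueX/uniformizer_value.
have [[c fc] [e ge]] := (val f f0 kf, val g g0 kg).
have := has_valueD fc ge; rewrite -mulrDl => /ordP_ge0.
rewrite mulf_neq0 ?invr_eq0 ?expfz_neq0 // => /(_ isT).
by rewrite ordPM ?invr_eq0 ?expfz_neq0 // ordPV ?expfz_neq0 //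
  ordP_uniformizerXz // subr_ge0.
Qed.

End Order.

(** * Zeros of rational functions *)

Section FiniteZeros.
Variables (K : closedFieldType) (Y : smoothProjCurve K).
Local Open Scope ring_scope.
Local Open Scope classical_set_scope.
Local Notation F := (pv_field Y).
Local Notation iota := (@pv_iota K Y).
Local Notation gen := (@pv_gen K Y).
Local Notation n := (pv_dim Y).+1.

Lemma finite_roots (q : {poly K}) : q != 0 ->
  exists s : seq K, forall x, root q x -> x \in s.
Proof.
move=> q0; have [s qE] := closed_field_poly_normal q; exists s => x.
by rewrite {1}qE rootZ ?lead_coef_eq0 // root_prod_XsubC.
Qed.

(** On the chart where the j-th coordinate does not vanish, each affine
    coordinate b is algebraically dependent on the function a of the form:
    q(b) = a r with q <> 0, so that q(b) vanishes where a does. *)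
Lemma form_zeros_coord d (G : dhomog n K d) (i j : 'I_n) :
  form_eval iota gen G != 0 ->
  exists s : seq K, forall P : closed_point Y,
    sval P j = 1 -> form_eval idfun (sval P) G = 0 -> sval P i \in s.
Proof.
move=> G0; have [gj|gj] := eqVneq (gen j) 0.
  exists [::] => P Pj; have [B Be] := @form_evalX K n j.
  have := @form_point_gen _ _ P _ B; rewrite !Be gj Pj oner_eq0 eqxx.
  by move=> /(_ isT).
pose a := form_eval iota gen G / gen j ^+ d.
have a0 : a != 0 by rewrite mulf_neq0 ?invr_eq0 ?expf_neq0.
have [q [Q q0 qQ]] := trdeg1_dvd (gen i / gen j) (curve_dim1 Y) a0.
have [s qs] := finite_roots q0.
exists s => P Pj GP; apply: qs.
have Pj0 : sval P j != 0 by rewrite Pj oner_eq0.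
have aP : has_value P a 0.
  have [C Ce] := form_evalXn K d j.
  by exists d, G, C; rewrite !Ce GP mul0r expf_neq0.
have bP := has_value_coord i Pj0; rewrite Pj divr1 in bP.
have [k rP] := has_value_eval2 Q aP bP.
have := has_valueM aP rP; rewrite -qQ mul0r => /has_value_fun h0.
exact/eqP/esym/h0/has_value_horner.
Qed.

Lemma finite_points (s : seq K) :
  finite_set [set P : closed_point Y | forall i, sval P i \in s].
Proof.
pose e (k : {ffun 'I_n -> seq_sub s}) := [ffun i => ssval (k i)].
apply: (@sub_finite_set _ _ ((fun P : closed_point Y => sval P) @^-1` (range e))).
  move=> P Ps /=; exists [ffun i => SeqSub (Ps i)] => //.
  by apply/ffunP => i; rewrite !ffunE.
apply: finite_preimage; last exact/finite_image/finite_finset.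
by move=> [p hp] [q hq] _ _ /= pq; apply: eq_exist.
Qed.

Lemma finite_form_zeros d (G : dhomog n K d) : form_eval iota gen G != 0 ->
  finite_set [set P : closed_point Y | form_eval idfun (sval P) G = 0].
Proof.
move=> G0.
have /choice [s hs] : forall ij : 'I_n * 'I_n, exists s : seq K,
    forall P : closed_point Y, sval P ij.2 = 1 ->
      form_eval idfun (sval P) G = 0 -> sval P ij.1 \in s.
  by move=> ij; apply: form_zeros_coord.
apply: sub_finite_set (finite_points (flatten [seq s ij | ij : 'I_n * 'I_n])).
move=> P GP i; have [[j [Pj _]] _] := svalP P.
apply/flattenP; exists (s (i, j)); last exact: hs.
by apply/mapP; exists (i, j); rewrite ?mem_enum.
Qed.

Lemma finite_ordP_neq0 (f : F) : f != 0 ->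
  finite_set [set P : closed_point Y | ordP P f <> 0].
Proof.
have [d [A [B [B0 fE]]]] := pv_fractions f => f0.
have A0 : form_eval iota gen A != 0.
  by apply: contra_neq f0 => A0; rewrite fE A0 mul0r.
have fin : finite_set ([set P : closed_point Y | form_eval idfun (sval P) A = 0]
    `|` [set P : closed_point Y | form_eval idfun (sval P) B = 0]).
  by rewrite finite_setU; split; apply: finite_form_zeros.
apply: sub_finite_set fin => P /= fP; apply: contrapT => /not_orP [/eqP AP /eqP BP].
apply/fP/ordP_unit; exists (form_eval idfun (sval P) A / form_eval idfun (sval P) B).
  by rewrite mulf_neq0 ?invr_eq0.
by exists d, A, B.
Qed.

End FiniteZeros.

(** * Existence of closed points *)

Section Nullstellensatz.
Variables (K : closedFieldType) (F : fieldType) (iota : {rmorphism K -> F}).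
Local Open Scope ring_scope.

(** The K-algebra A is a presentation of its image under psi, a subring of F:
    an integral domain whose K-points are the K-points of A that kill the
    kernel of psi.  The condition says that these are dense. *)
Definition dense_points (A : comNzRingType) (i : {rmorphism K -> A})
    (psi : {rmorphism A -> F}) : Prop :=
  (forall c, psi (i c) = iota c) /\
  forall b, psi b != 0 -> exists phi : {rmorphism A -> K},
    [/\ forall c, phi (i c) = c, phi b != 0 & forall g, psi g = 0 -> phi g = 0].

Section Adjoin.
Variables (A : comNzRingType) (i : {rmorphism K -> A}).
Variables (psi : {rmorphism A -> F}) (y : F).
Local Notation ev := (horner_eval y \o map_poly psi).
Implicit Types (b q g : {poly A}).

(** As psi is not injective, the leading coefficient of q may vanish in F; the
    offending terms of q are dropped before dividing by q. *)
Lemma trim_poly q : exists q', [/\ map_poly psi q' = map_poly psi q,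
  size q' = size (map_poly psi q) &
  psi (lead_coef q') = lead_coef (map_poly psi q)].
Proof.
pose q' := \poly_(j < size (map_poly psi q)) q`_j.
have e : map_poly psi q' = map_poly psi q.
  apply/polyP => j; rewrite !coef_map coef_poly; case: ifP => // /negbT.
  rewrite -leqNgt => /leq_sizeP/(_ j (leqnn j)); rewrite coef_map => ->.
  exact: rmorph0.
have s : size q' = size (map_poly psi q).
  apply/eqP; rewrite eqn_leq size_poly -[in X in (X <= _)%N]e.
  exact: size_poly.
by exists q'; split; rewrite // !lead_coefE s -e coef_map.
Qed.

(** If y is free over psi(A), it may be sent to any k, and all but finitely many
    choices of k keep b nonzero. *)
Lemma dense_points_transcendental :
  (forall q, ev q = 0 -> map_poly psi q = 0) ->
  dense_points i psi -> dense_points (polyC \o i) ev.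
Proof.
move=> tr [psii dense]; split=> [c|b evb] /=.
  by rewrite /horner_eval map_polyC hornerC; apply: psii.
have psib : map_poly psi b != 0.
  by apply: contra_neq evb => /= ->; rewrite /horner_eval horner0.
have := psib; rewrite -lead_coef_eq0 lead_coefE coef_map.
move=> /dense [phi [phii phib phi0]].
have /closed_nonrootP [k kb] : map_poly phi b != 0.
  apply: contra_neq phib => /(congr1 (fun p : {poly K} => p`_(size (map_poly psi b)).-1)).
  by rewrite coef_map coef0.
exists (horner_eval k \o map_poly phi); split=> //= [c|g evg].
  by rewrite /horner_eval map_polyC hornerC; apply: phii.
rewrite /horner_eval (_ : map_poly phi g = 0) ?horner0 //.
apply/polyP => j; rewrite coef_map coef0; apply: phi0.
by rewrite -coef_map tr ?coef0.
Qed.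

Section Algebraic.
Variable g : {poly A}.
Hypotheses (g_size : size g = size (map_poly psi g)).
Hypotheses (g_neq0 : map_poly psi g != 0) (evg : ev g = 0).
Hypothesis g_min : forall r, ev r = 0 -> (size (map_poly psi r) < size g)%N ->
  map_poly psi r = 0.

Lemma lead_min : psi (lead_coef g) != 0.
Proof. by rewrite lead_coefE g_size -coef_map -lead_coefE lead_coef_eq0. Qed.

Lemma pseudo_div b q : psi (lead_coef q) != 0 -> exists n p r,
  [/\ lead_coef q ^+ n *: b = p * q + r & (size r < size q)%N].
Proof.
move=> q0; exists (Pdiv.Ring.rscalp b q), (Pdiv.Ring.rdivp b q),
  (Pdiv.Ring.rmodp b q); split; first exact: Pdiv.ComRing.rdivp_eq.
rewrite Pdiv.Ring.ltn_rmodp; apply: contra_neq q0 => ->.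
by rewrite lead_coef0 rmorph0.
Qed.

Lemma evZ a q : ev (a *: q) = psi a * ev q.
Proof. by rewrite -mul_polyC rmorphM /= /horner_eval map_polyC hornerC. Qed.

Lemma evD p q : ev (p + q) = ev p + ev q.
Proof. exact: rmorphD. Qed.

Lemma evM p q : ev (p * q) = ev p * ev q.
Proof. exact: rmorphM. Qed.

Lemma evC a : ev a%:P = psi a.
Proof. by rewrite /= /horner_eval map_polyC hornerC. Qed.

(** Euclid's algorithm with g: as g is a minimal polynomial of y, no remainder
    that vanishes at y occurs before a constant is reached. *)
Lemma reduced_inverse b : (size b < size g)%N -> ev b != 0 ->
  exists B a, psi a != 0 /\ ev B * ev b = psi a.
Proof.
have [m] := ubnP (size b); elim: m b => // m IHm b bm bg evb.
have [b' [b'E b's b'l]] := trim_poly b.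
have evb' : ev b' = ev b by rewrite /= b'E.
have b'b : (size b' <= size b)%N by rewrite b's size_poly.
rewrite -evb' in evb *.
have b'0 : map_poly psi b' != 0.
  by apply: contra_neq evb => /= ->; rewrite /horner_eval horner0.
have [s1|s1] := leqP (size b') 1.
  have b'C := size1_polyC s1; exists 1, b'`_0.
  by rewrite rmorph1 mul1r -evC -b'C.
have lb : psi (lead_coef b') != 0 by rewrite b'l -b'E lead_coef_eq0.
have [e [q [r [qr rb]]]] := pseudo_div g lb.
have evr : ev r = - (ev q * ev b').
  have := congr1 ev qr; rewrite evZ evg mulr0 evD evM => /esym/eqP.
  by rewrite addrC addr_eq0 => /eqP.
have [r0|r0] := eqVneq (ev r) 0; last first.
  have [||B [a [a0 Ba]]] := IHm r _ _ r0.
  - by apply: leq_trans rb _; rewrite -ltnS (leq_ltn_trans b'b).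
  - exact: ltn_trans rb (leq_ltn_trans b'b bg).
  exists (- (B * q)), a; split=> //.
  by rewrite -Ba evr rmorphN rmorphM mulNr mulrN mulrA.
have psir : map_poly psi r = 0.
  apply: g_min => //; apply: leq_ltn_trans (size_poly _ _) _.
  exact: ltn_trans rb (leq_ltn_trans b'b bg).
have psiq : map_poly psi q * map_poly psi b' =
    psi (lead_coef b') ^+ e *: map_poly psi g.
  have := congr1 (map_poly psi) qr.
  by rewrite map_polyZ rmorphD rmorphM /= psir addr0 rmorphXn.
have ql : psi (lead_coef b') ^+ e != 0 by rewrite expf_neq0.
have q0 : map_poly psi q = 0.
  apply: g_min.
    move/eqP: r0; rewrite evr oppr_eq0 mulf_eq0 (negPf evb) orbF.
    by move/eqP.
  have [->|q0] := eqVneq (map_poly psi q) 0;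
    first by rewrite size_poly0 (leq_ltn_trans _ bg).
  rewrite g_size -(size_scale (map_poly psi g) ql) -psiq size_mul //.
  rewrite b'E -b's; case: (size b') s1 => [|[|k]] // _.
  by rewrite !addnS /= ltnS leq_addr.
by move/eqP: psiq; rewrite q0 mul0r eq_sym scaler_eq0 (negPf ql) (negPf g_neq0).
Qed.

(** If y is algebraic, it must be sent to a root of phi(g).  Keeping the leading
    coefficient s of g alive provides such a root and makes the extension well
    defined; keeping a multiple a of b alive, with a in A, keeps b nonzero. *)
Lemma dense_points_algebraic :
  dense_points i psi -> dense_points (polyC \o i) ev.
Proof.
move=> [psii dense]; split=> [c|b evb] /=.
  by rewrite /horner_eval map_polyC hornerC; apply: psii.
set s := lead_coef g; have s0 := lead_min.
have [e [q [r [qr rg]]]] := pseudo_div b s0.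
have evr : ev r = psi (s ^+ e) * ev b.
  by rewrite -evZ qr evD evM evg mulr0 add0r.
have [|B [a [a0 Ba]]] := reduced_inverse rg.
  by rewrite evr mulf_neq0 // rmorphXn expf_neq0.
have [|phi [phii + phi0]] := dense (s * a); first by rewrite rmorphM mulf_neq0.
rewrite rmorphM mulf_eq0 => /norP [phis phia].
have phig : size (map_poly phi g) = size g.
  by rewrite size_map_poly_id0.
have /closed_rootP [k gk] : size (map_poly phi g) != 1%N.
  rewrite phig; apply/eqP => /eqP/size_poly1P [c c0 gE].
  have /eqP := evg; rewrite gE evC -[c]lead_coefC -gE (negPf s0) //.
(* The extension is well defined: modulo g, h reduces to a remainder of
   smaller size that vanishes at y, hence is zero in F. *)
have van h : ev h = 0 -> (map_poly phi h).[k] = 0.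
  move=> h0; have [e' [q' [r' [qr' rg']]]] := pseudo_div h s0.
  have r'0 : map_poly phi r' = 0.
    apply/polyP => j; rewrite coef_map coef0; apply: phi0; rewrite -coef_map g_min ?coef0 //.
      have := congr1 ev qr'; rewrite evZ h0 mulr0 evD evM evg mulr0.
      by rewrite add0r.
    exact: leq_ltn_trans (size_poly _ _) rg'.
  have /eqP := congr1 (fun p => (map_poly phi p).[k]) qr'.
  rewrite map_polyZ rmorphD rmorphM /= r'0 addr0 hornerM (rootP gk) mulr0.
  rewrite hornerZ mulf_eq0 rmorphXn expf_eq0 (negPf phis) andbF /=.
  by move/eqP.
exists (horner_eval k \o map_poly phi); split=> //= [c|]; rewrite /horner_eval.
  by rewrite map_polyC hornerC; apply: phii.
have := van (B * r - a%:P); rewrite evD evM -polyCN evC rmorphN Ba subrr => /(_ erefl).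
move/eqP; rewrite rmorphD rmorphM /= map_polyC hornerD hornerM hornerC raddfN.
rewrite subr_eq0 => /eqP Br; apply: contra_neq phia => b0.
have /eqP := congr1 (fun p => (map_poly phi p).[k]) qr.
rewrite map_polyZ rmorphD rmorphM /= hornerD hornerM (rootP gk) mulr0.
by rewrite hornerZ b0 mulr0 add0r -Br => /eqP <-; rewrite mulr0.
Qed.

End Algebraic.

Lemma dense_points_adjoin : dense_points i psi -> dense_points (polyC \o i) ev.
Proof.
pose rel_size n := `[< exists g, [/\ map_poly psi g != 0, ev g = 0 &
  size (map_poly psi g) = n] >].
have [tr|/existsNP [g0 /not_implyP [evg0 /eqP psig0]]] :=
  pselect (forall q, ev q = 0 -> map_poly psi q = 0).
  exact: dense_points_transcendental.
have ex : exists n, rel_size n.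
  by exists (size (map_poly psi g0)); apply/asboolP; exists g0.
case: (ex_minnP ex) => n /asboolP [g [psig evg gn]] gmin.
have [g' [g'E g's _]] := trim_poly g.
apply: (@dense_points_algebraic g'); rewrite ?g'E //.
  by rewrite -evg /= g'E.
move=> r evr; rewrite g's gn ltnNge; apply: contraNeq => psir.
by apply: gmin; apply/asboolP; exists r.
Qed.

End Adjoin.

Lemma dense_points_generated (ys : seq F) :
  exists (A : comNzRingType) (i : {rmorphism K -> A}) (psi : {rmorphism A -> F}),
    dense_points i psi /\ forall y, y \in ys -> exists a, psi a = y.
Proof.
elim: ys => [|y ys [A [i [psi [dense gens]]]]].
  exists K, idfun, iota; split=> //; split=> // b b0.
  exists idfun; split=> //; first by move: b0; rewrite fmorph_eq0.
  by move=> g /eqP; rewrite fmorph_eq0 => /eqP.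
exists {poly A}, (polyC \o i), (horner_eval y \o map_poly psi).
split=> [|z]; first exact: dense_points_adjoin.
rewrite inE => /predU1P [->|/gens [a <-]].
  by exists 'X; rewrite /= /horner_eval map_polyX hornerX.
by exists a%:P; rewrite /= /horner_eval map_polyC hornerC.
Qed.

(** Nullstellensatz: the point y with coordinates in F specializes to a point
    with coordinates in K off the zeros of any polynomial that is nonzero at y. *)
Lemma mpoly_rational_point n (y : 'I_n -> F) (b : mpoly n K) :
  mmap iota y b != 0 ->
  exists p : 'I_n -> K, mmap idfun p b != 0 /\
    forall g, mmap iota y g = 0 -> mmap idfun p g = 0.
Proof.
have [A [i [psi [[psii dense] gens]]]] := dense_points_generated (codom y).
have /choice [a ay] : forall j, exists a, psi a = y j.
  by move=> j; apply/gens/codom_f.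
have psiE g : psi (mmap i a g) = mmap iota y g.
  by rewrite rmorph_mmap (funext psii : psi \o i = iota) (funext ay : psi \o a = y).
rewrite -psiE => /dense [phi [phii phib phi0]].
have phiE g : phi (mmap i a g) = mmap idfun (phi \o a) g.
  by rewrite rmorph_mmap (funext phii : phi \o i = idfun).
by exists (phi \o a); split=> [|g]; rewrite -phiE // -psiE; apply: phi0.
Qed.

End Nullstellensatz.

Section PointsExist.
Variables (K : closedFieldType) (Y : smoothProjCurve K).
Local Open Scope ring_scope.
Local Open Scope classical_set_scope.
Local Notation iota := (@pv_iota K Y).
Local Notation gen := (@pv_gen K Y).
Local Notation n := (pv_dim Y).+1.

(** The closed points are infinitely many: for each of finitely many points
    there is a form vanishing there but not on Y, and the generic point
    specializes to a closed point off the zeros of their product. *)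
Lemma nonempty_open_neq0 (U : set (closed_point Y)) :
  nonempty_open U -> U !=set0.
Proof.
move=> /(finite_image (fun P => sval P)) /finite_seqP [s sE].
have /choice [l hl] : forall p : {ffun 'I_n -> K}, exists l : mpoly n K,
    mmap iota gen l != 0 /\ forall (P : closed_point Y) c, sval P = p ->
      mmap idfun (fun i => c * p i) l = 0.
  move=> p; have [[P Pp]|nP] := pselect (exists P : closed_point Y, sval P = p);
    last by exists 1; rewrite rmorph1 oner_eq0; split=> // P c Pp; case: nP; exists P.
  have [f f0 [d [A [B [B0 fE /esym/eqP]]]]] := exists_vanishing P.
  rewrite mulf_eq0 invr_eq0 (negPf B0) orbF => /eqP AP; exists A; split=> [|_ c _].
    by apply: contra_neq f0 => A0; rewrite fE /form_eval A0 mul0r.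
  by have := form_eval_scale idfun (sval P) c A; rewrite AP mulr0 Pp.
have [j gj] := @pv_gen_neq0 K Y.
have [|p [pb pv]] := @mpoly_rational_point K _ iota n gen
    (mpolyX K (mnm1 j) * \prod_(q <- s) l q).
  rewrite rmorphM /= mmapX mmap1U rmorph_prod mulf_neq0 // prodf_seq_neq0.
  by apply/allP => q _; have [] := hl q.
move: pb; rewrite rmorphM /= mmapX mmap1U rmorph_prod mulf_eq0.
move=> /norP [pj]; rewrite prodf_seq_neq0 => /allP pl.
have [k pk kmin] := @arg_minnP _ j (fun i => p i != 0) (fun i => i : nat) pj.
pose P0 := [ffun i => (p k)^-1 * p i].
have P0E i : P0 i = (p k)^-1 * p i by rewrite ffunE.
have onP : normalized (V := Y) P0 /\ on_variety (V := Y) P0.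
  split=> [|d G /pv Gp].
    exists k; split=> [|i ik]; rewrite P0E ?mulVf //.
    have [->|/kmin] := eqVneq (p i) 0; first by rewrite mulr0.
    by rewrite leqNgt ik.
  rewrite (funext P0E : P0 = _ :> (_ -> _)) form_eval_scale.
  by rewrite /form_eval Gp mulr0.
pose P : closed_point Y := exist _ P0 onP.
exists P; apply: contrapT => nUP.
have P0s : P0 \in s.
  by have : [set` s] P0 by rewrite -sE; exists P.
have := pl P0 P0s; rewrite /= => /eqP; apply.
have [_ /(_ P (p k) erefl)] := hl P0; congr (mmap _ _ _ = _).
by apply/funext => i; rewrite P0E mulVKf.
Qed.

End PointsExist.

(** * Characters are linearly independent over the function field *)

Section Characters.
Variables (K : fieldType) (Y : smoothProjCurve K) (r : nat).
Local Open Scope ring_scope.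
Local Open Scope classical_set_scope.
Local Notation F := (pv_field Y).
Local Notation M := 'rV[int]_r.
Implicit Types (f g : F) (u w : M).

Lemma constXM f g : constX r (f * g) = constX r f * constX r g.
Proof. by rewrite /constX !rmorphM. Qed.

Lemma constX1 : constX r (1 : F) = 1.
Proof. by rewrite /constX !rmorph1. Qed.

Lemma constX0 : constX r (0 : F) = 0.
Proof. by rewrite /constX !rmorph0. Qed.

Lemma constXN f : constX r (- f) = - constX r f.
Proof. by rewrite /constX !rmorphN. Qed.

Lemma constX_div f g : g != 0 -> constX r (f / g) = constX r f / constX r g.
Proof.
move=> g0; have g1 : constX r g * constX r g^-1 = 1.
  by rewrite -constXM divff // constX1.
by rewrite constXM; congr (_ * _); apply/esym/(mulr1_eq g1).
Qed.

Lemma tofrac_var_neq0 (i : 'I_r) :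
  FracField.tofrac (mpolyX F (mnm1 i)) != 0.
Proof. by rewrite tofrac_eq0 -msupp_eq0 msuppX. Qed.

Lemma chiD u w : chi Y (u + w) = chi Y u * chi Y w.
Proof.
rewrite /chi -big_split; apply: eq_bigr => i _.
by rewrite mxE expfzDr ?tofrac_var_neq0.
Qed.

Lemma chi_monomial (m : multinom r) :
  chi Y (\row_i (m i)%:Z) = FracField.tofrac (mpolyX F m).
Proof.
rewrite mpolyXE_id rmorph_prod; apply: eq_bigr => i _.
by rewrite mxE rmorphXn.
Qed.

(** Multiplying by a large character turns the relation into one between
    monomials with coefficients in F. *)
Lemma chi_independent (s : seq (M * F)) w :
  \sum_(p <- s) constX r p.2 * chi Y p.1 = 0 ->
  \sum_(p <- s | p.1 == w) p.2 = 0.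
Proof.
move=> s0.
pose ws := w :: [seq p.1 | p <- s].
pose B := (\sum_(v <- ws) \sum_i `|v 0%R i|)%N.
have leB v i : v \in ws -> (`|v 0%R i| <= B)%N.
  move=> vs; rewrite /B (big_rem v) //= (bigD1 i) //=.
  by rewrite -!addnA leq_addr.
pose m (v : M) : multinom r := Multinom [tuple absz (v 0 i + B%:Z) | i < r].
have mE v : v \in ws -> v + const_mx B%:Z = \row_i (m v i)%:Z.
  move=> vs; apply/rowP => i; rewrite !mxE mnmE gez0_abs //.
  have := leB v i vs; rewrite -lez_nat; move: (v 0 i) => x xB.
  by rewrite -[x]opprK addrC subr_ge0; apply: le_trans xB; rewrite abszE -normrN ler_norm.
have m_inj v : v \in ws -> m v = m w -> v = w.
  move=> vs vw; apply: (addIr (const_mx B%:Z)).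
  by rewrite !mE ?vw ?inE ?eqxx.
have /eqP : \sum_(p <- s) FracField.tofrac (mpolyC r p.2 * mpolyX F (m p.1)) = 0.
  transitivity ((\sum_(p <- s) constX r p.2 * chi Y p.1) * chi Y (const_mx B%:Z));
    last by rewrite s0 mul0r.
  rewrite mulr_suml; apply: eq_big_seq => p ps; rewrite -mulrA -chiD mE; last first.
    by rewrite inE map_f ?orbT.
  by rewrite chi_monomial rmorphM.
rewrite -rmorph_sum tofrac_eq0 => /eqP /(congr1 (mcoeff (m w))).
rewrite mcoeff0 raddf_sum => h; rewrite -[RHS]h big_mkcond.
apply: eq_big_seq => p ps; rewrite /= mcoeffCM mcoeffX.
have -> : (m p.1 == m w) = (p.1 == w).
  by apply/eqP/eqP => [/m_inj-> //|-> //]; rewrite inE map_f ?orbT.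
by case: ifP => _; rewrite ?mulr1 ?mulr0.
Qed.

Lemma chi_coefficient (s : seq (M * F)) g w :
  constX r g * chi Y w = \sum_(p <- s) constX r p.2 * chi Y p.1 ->
  g = \sum_(p <- s | p.1 == w) p.2.
Proof.
move=> gs; have := @chi_independent ((w, - g) :: s) w.
rewrite !big_cons /= eqxx constXN mulNr -gs addNr => /(_ erefl) /eqP.
by rewrite addrC subr_eq0 => /eqP.
Qed.

Lemma Gamma_sum (I : eqType) (U : set (closed_point Y))
    (E : closed_point Y -> rat) (s : seq I) (A : pred I) (f : I -> F) :
  (forall i, i \in s -> A i -> Gamma U (fun P => (E P)%:E) (f i)) ->
  Gamma U (fun P => (E P)%:E) (\sum_(i <- s | A i) f i).
Proof.
have leE P (x : int) : (0 <= x%:~R%:E + (E P)%:E)%E = (- E P <= x%:~R).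
  by rewrite -EFinD lee_fin -[X in _ + X]opprK subr_ge0.
have GE g : Gamma U (fun P => (E P)%:E) g <->
    g = 0 \/ forall P, U P -> - E P <= (ordP P g)%:~R.
  by split=> -[->|h]; [left| |left|]; auto; right => P UP; have := h P UP;
     rewrite leE.
move=> fs; rewrite big_seq_cond; elim/big_ind: _ => [|f1 f2|i /andP [si Ai]].
- by left.
- move=> /GE [-> g2|f1E] ; first by rewrite add0r.
  move=> /GE [->|f2E]; first by rewrite addr0; apply/GE; right.
  apply/GE.
  have [->|f0] := eqVneq (f1 + f2) 0; [by left|right=> P UP].
  have [e1|n1] := eqVneq f1 0; first by rewrite e1 add0r; apply: f2E.
  have [e2|n2] := eqVneq f2 0; first by rewrite e2 addr0; apply: f1E.
  have := ordPD n1 n2 f0.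
  have [l12|/ltW l21] := leP (ordP P f1) (ordP P f2).
    by move=> /(_ P _ (lexx _) l12) h; apply: le_trans (f1E P UP) _; rewrite ler_int.
  by move=> /(_ P _ l21 (lexx _)) h; apply: le_trans (f2E P UP) _; rewrite ler_int.
exact: fs.
Qed.

(** By independence of the characters, the coefficient of chi^w in an element of
    the coordinate ring is a sum of sections of D(w). *)
Lemma ringX_homogeneous (D : polyDiv Y r) g w : g != 0 ->
  ringX D (constX r g * chi Y w) <->
  dual_cone (pd_tail D) (toQ w) /\
  Gamma (Loc D) (fun P => (pdiv_eval D (toQ w) P)%:E) g.
Proof.
move=> g0; split=> [[s [sD /chi_coefficient gs]]|gw]; last first.
  exists [:: (w, g)]; split=> [p|]; first by rewrite inE => /eqP ->.
  by rewrite big_seq1.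
have hw : exists2 p, p \in s & p.1 = w.
  have [/hasP [p ps /eqP pw]|/hasPn no] := boolP (has (fun p => p.1 == w) s).
    by exists p.
  by case/eqP: g0; rewrite gs big_seq_cond big1 // => p /andP [/no /negPf ->].
have [p ps pw] := hw; split; first by rewrite -pw; apply: (sD p ps).1.
by rewrite gs; apply: Gamma_sum => q qs /eqP <-; apply: (sD q qs).2.
Qed.

End Characters.

(** * Polyhedra and their vertices *)

Section Pairing.
Variable r : nat.
Local Open Scope ring_scope.
Implicit Types u v w : 'rV[rat]_r.

Lemma pairingE u v : pairing u v = (u *m v^T) 0 0.
Proof. by rewrite mxE; apply: eq_bigr => i _; rewrite mxE. Qed.

Lemma pairingDl u v w : pairing (u + v) w = pairing u w + pairing v w.
Proof. by rewrite !pairingE mulmxDl mxE. Qed.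

Lemma pairingDr u v w : pairing u (v + w) = pairing u v + pairing u w.
Proof. by rewrite !pairingE linearD mulmxDr mxE. Qed.

Lemma pairingNl u v : pairing (- u) v = - pairing u v.
Proof. by rewrite !pairingE mulNmx mxE. Qed.

Lemma pairingBl u v w : pairing (u - v) w = pairing u w - pairing v w.
Proof. by rewrite pairingDl pairingNl. Qed.

Lemma pairingZr a u v : pairing u (a *: v) = a * pairing u v.
Proof. by rewrite !pairingE linearZ -scalemxAr mxE. Qed.

Lemma pairing_sumr (I : Type) (s : seq I) u (f : I -> 'rV[rat]_r) :
  pairing u (\sum_(i <- s) f i) = \sum_(i <- s) pairing u (f i).
Proof.
elim/big_ind2: _ => [|x a y b <- <-|//]; first by rewrite pairingE trmx0 mulmx0 mxE.
by rewrite pairingDr.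
Qed.

Lemma toQB (u v : 'rV[int]_r) : toQ (u - v) = toQ u - toQ v.
Proof. by apply/rowP => i; rewrite !mxE intrD intrN. Qed.

Lemma minvalE (A : set rat) m :
  A m -> (forall x, A x -> m <= x) -> minval A = m.
Proof.
move=> Am mA; rewrite /minval; case: xgetP => [x _ [Ax xA]|/(_ m) []//].
by apply/le_anti; rewrite xA // mA.
Qed.

End Pairing.

Section Vertices.
Variables (r : nat) (sigma : set 'rV[rat]_r).
Hypotheses (sigma_cone : polyhedral_cone sigma) (sigma_pointed : pointed sigma).
Local Open Scope ring_scope.
Local Open Scope classical_set_scope.
Local Notation VQ := 'rV[rat]_r.

Lemma cone0 : sigma 0.
Proof.
have [k [g ->]] := sigma_cone; exists (fun=> 0) => //.
by rewrite big1 // => i _; rewrite scale0r.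
Qed.

Lemma coneD v w : sigma v -> sigma w -> sigma (v + w).
Proof.
have [k [g ->]] := sigma_cone => -[c c0 ->] [e e0 ->].
exists (fun i => c i + e i) => [i|]; first by rewrite addr_ge0.
by rewrite -big_split; apply: eq_bigr => i _; rewrite scalerDl.
Qed.

Lemma coneZ a v : 0 <= a -> sigma v -> sigma (a *: v).
Proof.
have [k [g ->]] := sigma_cone => a0 -[c c0 ->].
exists (fun i => a * c i) => [i|]; first by rewrite mulr_ge0.
by rewrite scaler_sumr; apply: eq_bigr => i _; rewrite scalerA.
Qed.

Definition hull_plus k (g : 'I_k -> VQ) : set VQ :=
  [set a + b | a in conv_hull g & b in sigma].

Lemma hull_plusP k (g : 'I_k -> VQ) v : hull_plus g v <->
  exists c s, [/\ forall i, 0 <= c i, \sum_i c i = 1, sigma s &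
    v = \sum_i c i *: g i + s].
Proof.
split=> [[_ [c [c0 c1 ->]] [s ss <-]]|[c [s [c0 c1 ss ->]]]]; first by exists c, s.
by exists (\sum_i c i *: g i); [exists c|exists s].
Qed.

Lemma hull_plus_gen k (g : 'I_k -> VQ) i : hull_plus g (g i).
Proof.
apply/hull_plusP; exists (fun j => (j == i)%:R), 0; split.
- by move=> j; rewrite ler0n.
- by rewrite (bigD1 i) //= eqxx big1 ?addr0 // => j /negPf ->.
- exact: cone0.
rewrite addr0 (bigD1 i) //= eqxx scale1r big1 ?addr0 // => j /negPf ->.
by rewrite scale0r.
Qed.

Lemma hull_plus_tail k (g : 'I_k -> VQ) v s :
  hull_plus g v -> sigma s -> hull_plus g (v + s).
Proof.
move=> /hull_plusP [c [t [c0 c1 st ->]]] ss; apply/hull_plusP.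
by exists c, (t + s); rewrite addrA; split=> //; apply: coneD.
Qed.

Lemma big_lift k (V : nmodType) (f : 'I_k.+1 -> V) i :
  \sum_j f j = f i + \sum_j f (lift i j).
Proof. by rewrite (bigD1_ord i). Qed.

(** As e i <> 1, the relation can be solved for g i and substituted. *)
Lemma hull_plus_drop k (g : 'I_k.+1 -> VQ) i (e : 'I_k.+1 -> rat) s :
  (forall j, 0 <= e j) -> \sum_j e j = 1 -> e i != 1 -> sigma s ->
  g i = \sum_j e j *: g j + s -> hull_plus g = hull_plus (g \o lift i).
Proof.
move=> e0 e1 ei1 ss gi.
have ei_le1 : e i <= 1 by rewrite -e1 (bigD1 i) //= lerDl sumr_ge0.
have ei_lt1 : 0 < 1 - e i by rewrite subr_gt0 lt_neqAle ei1.
have d_neq0 : 1 - e i != 0 by rewrite gt_eqF.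
have gi' : g i = \sum_j (e (lift i j) / (1 - e i)) *: g (lift i j)
    + (1 - e i)^-1 *: s.
  apply: (scalerI d_neq0); rewrite scalerDr scalerA divff // scale1r.
  rewrite scalerBl scale1r {1}gi (big_lift _ i) -[_ + s]addrA [_ + (_ + s)]addrC addrK.
  congr (_ + _); rewrite scaler_sumr; apply: eq_bigr => j _.
  by rewrite scalerA mulrC divfK.
have sum1 : \sum_j e (lift i j) / (1 - e i) = 1.
  rewrite -mulr_suml; apply: (mulIf d_neq0); rewrite divfK // mul1r.
  by rewrite -[X in X - _]e1 (big_lift _ i) [RHS]addrC addKr.
apply/seteqP; split=> v /hull_plusP [c [t [c0 c1 st ->]]]; apply/hull_plusP.
  exists (fun j => c (lift i j) + c i * (e (lift i j) / (1 - e i))),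
    (c i *: ((1 - e i)^-1 *: s) + t); split.
  - by move=> j; rewrite addr_ge0 // mulr_ge0 // divr_ge0 // ltW.
  - by rewrite big_split /= -mulr_sumr sum1 mulr1 addrC -big_lift.
  - by apply/coneD/st/coneZ/coneZ => //; rewrite invr_ge0 ltW.
  rewrite (big_lift _ i) {1}gi' scalerDr scaler_sumr addrA; congr (_ + _).
  rewrite addrC addrA; congr (_ + _); rewrite -big_split; apply: eq_bigr => j _.
  by rewrite /= scalerA -scalerDl.
exists (fun j => if unlift i j is Some l then c l else 0), t; split=> //.
- by move=> j; case: unliftP.
- by rewrite (big_lift _ i) unlift_none add0r -c1; apply: eq_bigr => j _; rewrite liftK.
rewrite (big_lift _ i) unlift_none scale0r add0r; congr (_ + _).
by apply: eq_bigr => j _; rewrite liftK.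
Qed.

(** In a generating family of least length every generator is a vertex: a
    nontrivial segment through it would make it redundant, or exhibit a line
    in sigma. *)
Lemma has_tailcone_vertices (Delta : set VQ) : has_tailcone sigma Delta ->
  exists k (g : 'I_k.+1 -> VQ),
    Delta = hull_plus g /\ forall i, is_vertex Delta (g i).
Proof.
move=> [k0 [g0 Dg0]].
pose gen_size k := `[< exists g : 'I_k.+1 -> VQ, Delta = hull_plus g >].
have ex : exists k, gen_size k by exists k0; apply/asboolP; exists g0.
case: (ex_minnP ex) => k /asboolP [g Dg] kmin; exists k, g; split=> // i.
split; first by rewrite Dg; apply: hull_plus_gen.
rewrite Dg => a b t /hull_plusP [c [s [c0 c1 ss ->]]].
move=> /hull_plusP [d [s' [d0 d1 ss' ->]]] /andP [t0 t1] gi.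
have t'0 : 0 < 1 - t by rewrite subr_gt0.
pose e j := t * c j + (1 - t) * d j.
have e0 j : 0 <= e j by rewrite addr_ge0 // mulr_ge0 // ltW.
have e1 : \sum_j e j = 1.
  by rewrite big_split /= -!mulr_sumr c1 d1 !mulr1 addrC subrK.
have gE : g i = \sum_j e j *: g j + (t *: s + (1 - t) *: s').
  rewrite {1}gi !scalerDr addrACA; congr (_ + _).
  rewrite !scaler_sumr -big_split; apply: eq_bigr => j _.
  by rewrite !scalerA scalerDl.
have es : sigma (t *: s + (1 - t) *: s')
  by apply/coneD/coneZ => //; [apply: coneZ|]; rewrite ?ltW.
(* If e i < 1 the generator is redundant; if e i = 1 both ends of the segment are
   g i plus an element of sigma, and these two elements cancel. *)
have [ei|ei] := eqVneq (e i) 1; last first.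
  case: k => [|k] in g Dg kmin i c c0 c1 d d0 d1 gi e e0 e1 gE ei *.
    by move: e1 ei; rewrite big_ord1 (ord1 i) => ->; rewrite eqxx.
  suff /kmin : gen_size k by rewrite ltnn.
  by apply/asboolP; exists (g \o lift i); rewrite Dg; apply: hull_plus_drop gE.
have le1 (f : 'I_k.+1 -> rat) : (forall j, 0 <= f j) -> \sum_j f j = 1 -> f i <= 1.
  by move=> f0 <-; rewrite (bigD1 i) //= lerDl sumr_ge0.
have one (f : 'I_k.+1 -> rat) : (forall j, 0 <= f j) -> \sum_j f j = 1 ->
    f i = 1 -> \sum_j f j *: g j = g i.
  move=> f0 f1 fi; rewrite (bigD1 i) //= fi scale1r big1 ?addr0 // => j ji.
  have /eqP := f1; rewrite (bigD1 i) //= fi -subr_eq0 addrAC subrr add0r.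
  rewrite psumr_eq0 // => /allP /(_ j (mem_index_enum _)); rewrite ji /=.
  by move=> /eqP ->; rewrite scale0r.
have ci1 := le1 c c0 c1; have di1 := le1 d d0 d1.
have [ci di] : c i = 1 /\ d i = 1 by move: ei; rewrite /e => ei; split; nra.
have eqs : t *: s + (1 - t) *: s' = 0.
  by apply: (addrI (g i)); rewrite addr0 [in RHS]gE one.
have zero x y p q : 0 < p -> 0 < q -> sigma x -> sigma y ->
    p *: x + q *: y = 0 -> x = 0.
  move=> p0 q0 sx sy /eqP; rewrite addr_eq0 => /eqP pq; apply: sigma_pointed => //.
  have -> : - x = (q / p) *: y.
    apply: (scalerI (lt0r_neq0 p0)); rewrite scalerN pq opprK scalerA.
    by rewrite mulrC divfK // lt0r_neq0.
  by apply: coneZ => //; rewrite divr_ge0 // ltW.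
have s0 : s = 0 by apply: zero eqs.
have s'0 : s' = 0 by apply: zero ss' ss _; rewrite 1?addrC; [| |exact: eqs].
by rewrite s0 s'0 !addr0 !one.
Qed.

Lemma min_at_vertex (Delta : set VQ) (w : VQ) : has_tailcone sigma Delta ->
  (forall s, sigma s -> 0 <= pairing w s) ->
  exists v, is_vertex Delta v /\ forall x, Delta x -> pairing w v <= pairing w x.
Proof.
move=> /has_tailcone_vertices [k [g [Dg gv]]] w0.
have [i _ imin] := @Order.TotalTheory.arg_minP _ _ _ ord0 xpredT
  (fun i => pairing w (g i)) isT.
exists (g i); split=> // x; rewrite Dg => /hull_plusP [c [s [c0 c1 ss ->]]].
rewrite pairingDr -[leLHS]addr0 lerD ?w0 // pairing_sumr -[leLHS]mul1r -c1 mulr_suml.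
by apply: ler_sum => j _; rewrite pairingZr ler_wpM2l // imin.
Qed.

End Vertices.

(** * Integral affine functions *)

Section IntegralExtension.
Local Open Scope ring_scope.

Definition integral_mx m n (A : 'M[rat]_(m, n)) : Prop :=
  exists B : 'M[int]_(m, n), A = map_mx intr B.

Lemma integral_mxP m n (A : 'M[rat]_(m, n)) :
  integral_mx A <-> forall i j, A i j \is a Num.int.
Proof.
split=> [[B ->] i j|Aint]; first by rewrite mxE intr_int.
have /choice [f fE] : forall ij, exists z : int, A ij.1 ij.2 = z%:~R.
  by move=> ij; apply/intrP/Aint.
by exists (\matrix_(i, j) f (i, j)); apply/matrixP => i j; rewrite !mxE -fE.
Qed.

Lemma clear_denominators m n (A : 'M[rat]_(m, n)) :
  exists2 D : nat, (0 < D)%N & integral_mx (D%:R *: A).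
Proof.
have [D D0 DA] : exists2 D : nat, (0 < D)%N &
    forall x, x \in [seq A ij.1 ij.2 | ij : 'I_m * 'I_n] -> D%:R * x \is a Num.int.
  elim: [seq _ | _ : _] => [|x s [D D0 Ds]]; first by exists 1%N.
  exists (D * absz (denq x))%N; first by rewrite muln_gt0 D0 absz_gt0 denq_eq0.
  have dE : (absz (denq x))%:R = (denq x)%:~R :> rat.
    by rewrite -[LHS]/((Posz (absz (denq x)))%:~R) gez0_abs.
  move=> y; rewrite inE natrM => /predU1P [->|/Ds ys].
    by rewrite -mulrA dE [_ * x]mulrC -numqE rpredM ?natr_int ?intr_int.
  by rewrite mulrAC rpredM // natr_int.
exists D => //; apply/integral_mxP => i j; rewrite mxE; apply: DA.
by apply/mapP; exists (i, j); rewrite ?mem_enum.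
Qed.

(** A linear form that is integral on the lattice points of the row space of G
    agrees there with an integral linear form, because these lattice points
    form a saturated sublattice; the Smith normal form of G gives a complement. *)
Lemma integral_extension m n (G : 'M[rat]_(m, n)) (H : 'cV[rat]_n) :
  (forall y : 'rV_m, integral_mx (y *m G) -> integral_mx (y *m G *m H)) ->
  exists z : 'cV[int]_n, G *m map_mx intr z = G *m H.
Proof.
move=> Hint; have [D D0 [G' DG]] := clear_denominators G.
have DQ : (D%:R : rat) != 0 by rewrite pnatr_eq0 -lt0n.
have [L Lu [R Ru [d _ G'E]]] := int_Smith_normal_form G'.
pose Q k l (A : 'M[int]_(k, l)) : 'M[rat]_(k, l) := map_mx intr A.
pose E : 'M[int]_(m, n) := \matrix_(i, j) (d`_i *+ (i == j :> nat)).
have DGE : D%:R *: G = Q _ _ L *m Q _ _ E *m Q _ _ R by rewrite DG G'E !map_mxM.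
have QV k (A : 'M[int]_k) : A \in unitmx -> Q _ _ (invmx A) *m Q _ _ A = 1%:M.
  by move=> Au; rewrite -map_mxM mulVmx // map_mx1.
have row_int (j : 'I_m) (i : 'I_n) : i = j :> nat -> d`_j != 0 ->
    integral_mx (row i (Q _ _ R) *m H).
  move=> ij dj0; have djQ : ((d`_j)%:~R : rat) != 0 by rewrite intr_eq0.
  have LG : Q _ _ (invmx L) *m (D%:R *: G) = Q _ _ E *m Q _ _ R.
    by rewrite DGE !mulmxA QV // mul1mx.
  have RG : ((D%:R / (d`_j)%:~R) *: row j (Q _ _ (invmx L))) *m G = row i (Q _ _ R).
    transitivity ((d`_j)%:~R^-1 *: row j (Q _ _ (invmx L) *m (D%:R *: G))).
      by rewrite row_mul -scalemxAl mulrC -scalerA -scalemxAr.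
    rewrite LG; apply/rowP => k; rewrite !mxE (bigD1 i) //= !mxE ij eqxx mulr1n.
    rewrite big1 ?addr0 ?mulKf // => l li; rewrite !mxE.
    have /negPf -> : (j : nat) != l by rewrite -ij eq_sym.
    by rewrite mulr0n mul0r.
  by rewrite -RG; apply: Hint; rewrite RG; exists (row i R); rewrite map_row.
(* The rows of R with nonzero elementary divisor span the saturation of the row
   lattice; prescribe the values of H there, and 0 on the other rows of R. *)
have /choice [e eE] : forall i, exists e : int, forall j : 'I_m,
    (E j i)%:~R * (e%:~R : rat) = (E j i)%:~R * (Q _ _ R *m H) i 0.
  move=> i; have [[j [ij dj]]|no] := pselect (exists j : 'I_m, i = j :> nat /\ d`_j != 0).
    have /integral_mxP /(_ 0 0) /intrP [e eE] := row_int j i ij dj.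
    by exists e => k; congr (_ * _); rewrite -eE -row_mul [LHS]mxE.
  exists 0 => j; rewrite mxE; have [ji|] := eqVneq (j : nat) i; last first.
    by rewrite mulr0n !mul0r.
  have [->|dj] := eqVneq d`_j 0; first by rewrite mul0rn !mul0r.
  by case: no; exists j.
exists (invmx R *m \col_i e i); apply: (scalerI DQ).
rewrite !scalemxAl DGE map_mxM -[_ *m Q _ _ R *m _]mulmxA.
rewrite [Q _ _ R *m _]mulmxA -[X in X *m map_mx _ (\col_i e i)]map_mxM mulmxV // map_mx1 mul1mx.
rewrite -!mulmxA; congr (_ *m _); apply/matrixP => j k; rewrite [LHS]mxE [RHS]mxE.
apply: eq_bigr => i _; have -> : Q _ _ E j i = (E j i)%:~R by rewrite mxE.
by rewrite (ord1 k) -eE; congr (_ * _); rewrite !mxE.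
Qed.

End IntegralExtension.

Section IntegralAffine.
Variables (r : nat) (sigma Delta : set 'rV[rat]_r) (phi : 'rV[rat]_r -> rat).
Local Open Scope ring_scope.
Local Open Scope classical_set_scope.

(** Homogenize: phi is the restriction to height 1 of a linear form on the span
    of the cone over Delta.  A lattice point of that span is the difference of
    two lattice points of positive height in the cone over Delta, where the
    linear form is integral by hypothesis. *)
Lemma integral_affine : polyhedral_cone sigma -> has_tailcone sigma Delta ->
  affine_on Delta phi ->
  (forall (k : nat) v, Delta v -> (exists w : 'rV[int]_r, k%:R *: v = toQ w) ->
     k%:R * phi v \is a Num.int) ->
  exists (u : 'rV[int]_r) (c : int),
    forall v, Delta v -> phi v = pairing (toQ u) v + c%:~R.
Proof.
move=> [l [s sE]] [k [g DE]] [a [c phiE]] phi_int.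
have sc : polyhedral_cone sigma by exists l, s.
pose G : 'M[rat]_(k.+1 + l, r + 1) :=
  block_mx (\matrix_i g i) (const_mx 1) (\matrix_i s i) 0.
pose H : 'cV[rat]_(r + 1) := col_mx a^T (const_mx c).
have hom v (x : rat) : (row_mx v x%:M *m H) 0 0 = pairing a v + x * c.
  rewrite mul_row_col mxE; congr (_ + _); last by rewrite mul_scalar_mx !mxE.
  by rewrite mxE; apply: eq_bigr => i _; rewrite mxE mulrC.
have rowG (y : 'rV_(k.+1 + l)) : y *m G =
    row_mx (\sum_i y 0 (lshift l i) *: g i + \sum_j y 0 (rshift k.+1 j) *: s j)
           (\sum_i y 0 (lshift l i))%:M.
  rewrite -[y in LHS]hsubmxK mul_row_block mulmx0 addr0; congr row_mx.
    rewrite !mulmx_sum_row; congr (_ + _); apply: eq_bigr => i _;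
      by rewrite rowK mxE.
  apply/matrixP => i j; rewrite (ord1 i) (ord1 j) !mxE eqxx mulr1n.
  by apply: eq_bigr => i' _; rewrite !mxE mulr1.
(* The point x / q of Delta has height 1 on the ray through the lattice point
   (x, q), and q is the denominator to which the hypothesis applies. *)
have posint (y : 'rV_(k.+1 + l)) : (forall i, 0 < y 0 i) ->
    integral_mx (y *m G) -> (y *m G *m H) 0 0 \is a Num.int.
  move=> y0; rewrite rowG hom; set q := \sum_i y 0 _; set x := _ + _ => -[B BE].
  have q0 : 0 < q.
    by rewrite /q big_ord_recl ltr_pwDl // sumr_ge0 // => i _; apply: ltW.
  have [n qn] : exists n : nat, q = n%:R.
    have /intrP [z qz] : q \is a Num.int.
      have := congr1 (fun A => rsubmx A 0 0) BE.
      by rewrite row_mxKr !mxE eqxx mulr1n => qB; apply/intrP; exists (B 0 (rshift r 0)).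
    case: z qz => n qn; first by exists n.
    by move: q0; rewrite qn ltr0z.
  have xq : q *: (q^-1 *: x) = x by rewrite scalerA divff ?scale1r ?gt_eqF.
  have Dx : Delta (q^-1 *: x).
    rewrite DE; apply/(hull_plusP sigma).
    exists (fun i => y 0 (lshift l i) / q),
      (\sum_j (y 0 (rshift k.+1 j) / q) *: s j); split.
    - by move=> i; rewrite divr_ge0 // ltW.
    - by rewrite -mulr_suml divff // gt_eqF.
    - rewrite sE; exists (fun j => y 0 (rshift k.+1 j) / q) => // j.
      by rewrite divr_ge0 // ltW.
    rewrite scalerDr !scaler_sumr; congr (_ + _); apply: eq_bigr => i _;
      by rewrite scalerA mulrC.
  have := phi_int n _ Dx; rewrite -qn xq phiE // mulrDr -pairingZr xq.
  apply; exists (lsubmx B); have := congr1 lsubmx BE.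
  by rewrite row_mxKl => ->; apply/rowP => i; rewrite !mxE.
have Hint (y : 'rV_(k.+1 + l)) : integral_mx (y *m G) -> integral_mx (y *m G *m H).
  move=> yG; apply/integral_mxP => i j; rewrite (ord1 i) (ord1 j).
  have [D D0 DG] := clear_denominators G.
  (* Shifting by N times the sum of all generators makes the coefficients
     positive and preserves integrality, as N is a multiple of D. *)
  pose N := (D * (\sum_i Num.bound (`|y 0 i|)%R).+1)%N.
  have Ny i' : `|y 0 i'| < N%:R.
    have := archi_boundP (normr_ge0 (y 0 i')) => /lt_le_trans; apply.
    rewrite ler_nat /N (bigD1 i') //=; apply: leq_trans (leq_pmull _ D0).
    by rewrite leqW ?leq_addr.
  pose w : 'rV[rat]_(k.+1 + l) := const_mx N%:R.
  have w_int : integral_mx (w *m G).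
    apply/integral_mxP => i' j'; rewrite mxE rpred_sum // => t _.
    have -> : w i' t = N%:R by rewrite mxE.
    rewrite /N natrM mulrAC rpredM ?natr_int //.
    by have /integral_mxP /(_ t j') := DG; rewrite mxE.
  have -> : (y *m G *m H) 0 0 = ((w + y) *m G *m H) 0 0 - (w *m G *m H) 0 0.
    have mxD (A B : 'M[rat]_1) : (A + B) 0 0 = A 0 0 + B 0 0 by rewrite mxE.
    by rewrite !mulmxDl mxD addrAC subrr add0r.
  rewrite rpredB // posint //; first 1 last.
  - apply/integral_mxP => i' j'; rewrite mulmxDl mxE rpredD //.
      by have /integral_mxP := w_int.
    by have /integral_mxP := yG.
  - by move=> i'; rewrite mxE ltr0n muln_gt0 D0.
  move=> i'; rewrite !mxE -[y 0 i']opprK subr_gt0.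
  by apply: le_lt_trans (Ny i'); rewrite -normrN ler_norm.
have [z zE] := integral_extension Hint.
exists (usubmx z)^T, (dsubmx z 0 0) => v; rewrite DE => Dv.
have := Dv => /(hull_plusP sigma) [cg [t [_ cg1 + vE]]].
rewrite sE => -[ct _ tE].
have vG : row_mx v 1%:M = row_mx (\row_i cg i) (\row_j ct j) *m G.
  rewrite rowG; congr row_mx.
    rewrite vE tE; congr (_ + _); apply: eq_bigr => i _.
      by rewrite row_mxEl mxE.
    by rewrite row_mxEr mxE.
  by congr (_%:M); rewrite -cg1; apply: eq_bigr => i _; rewrite row_mxEl mxE.
rewrite phiE ?DE // -[c]mul1r -hom vG -mulmxA -zE mulmxA -vG.
rewrite -[z]vsubmxK map_col_mx mul_row_col mxE mul1mx.
rewrite !col_mxKu !col_mxKd; congr (_ + _); last by rewrite mxE.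
by rewrite mxE; apply: eq_bigr => i _; rewrite !mxE mulrC.
Qed.

End IntegralAffine.

(** * Sections of the divisor of a support function *)

Section FiniteMinimum.
Local Open Scope ring_scope.
Local Open Scope classical_set_scope.

Lemma seq_min (s : seq rat) (x0 : rat) : x0 \in s ->
  exists2 m, m \in s & forall x, x \in s -> m <= x.
Proof.
elim: s x0 => // y s IHs x0 _; case: s IHs => [|z s] IHs.
  by exists y; rewrite ?inE // => x; rewrite inE => /eqP ->.
have [m ms mmin] := IHs z (mem_head _ _).
have [ym|/ltW my] := leP y m.
  exists y; rewrite ?mem_head // => x; rewrite inE => /predU1P [->//|/mmin].
  exact: le_trans.
exists m; first by rewrite inE ms orbT.
by move=> x; rewrite inE => /predU1P [->//|/mmin].
Qed.

Lemma finite_argmin (T : Type) (A : set T) (f : T -> rat) :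
  finite_set A -> A !=set0 -> exists2 a, A a & forall b, A b -> f a <= f b.
Proof.
move=> /(finite_image f) /finite_seqP [s sE] [a Aa].
have ms x : x \in s <-> (f @` A) x by rewrite sE.
have [|_ /ms [b Ab <-] bmin] := @seq_min s (f a); first by apply/ms; exists a.
by exists b => // c Ac; apply/bmin/ms; exists c.
Qed.

End FiniteMinimum.

Section Sections.
Variables (K : closedFieldType) (Y : smoothProjCurve K) (r : nat).
Variables (S : set (polyDiv Y r)).
Variables (h : closed_point Y -> 'rV[rat]_r -> rat) (ht : 'rV[rat]_r -> rat).
Hypotheses (fanS : divisorial_fan S) (hh : CaSF S h ht).
Local Open Scope ring_scope.
Local Open Scope classical_set_scope.
Local Notation F := (pv_field Y).
Local Notation pt := (closed_point Y).
Local Notation VQ := 'rV[rat]_r.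
Local Notation M := 'rV[int]_r.
Implicit Types (D : polyDiv Y r) (U : set pt) (P : pt) (u : M) (f : F).

Lemma fan_polyDiv D : S D -> is_polyDiv D.
Proof. by case: fanS => _ h1 _ /h1 []. Qed.

Lemma fan_cone D : S D -> polyhedral_cone (pd_tail D).
Proof. by move/fan_polyDiv; case. Qed.

Lemma fan_pointed D : S D -> pointed (pd_tail D).
Proof. by move/fan_polyDiv; case. Qed.

Lemma fan_tailcone D P : S D -> Loc D P -> has_tailcone (pd_tail D) (pd_coef D P).
Proof.
move=> /fan_polyDiv [_ _ /(_ P) [D0|//] _] [v]; by rewrite D0.
Qed.

Lemma fan_Loc_open D : S D -> nonempty_open (Loc D).
Proof.
move=> SD; have [_ _ _] := fan_polyDiv SD; apply: sub_finite_set => P /= nP DP.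
by apply: nP; exists 0; rewrite DP; apply: cone0 (fan_cone SD).
Qed.

Lemma support_tail D P p v : S D -> pd_coef D P p -> pd_tail D v ->
  h P (p + v) - h P p = ht v.
Proof. by case: hh => -[_ h2 _] _; apply: h2. Qed.

Lemma coef_tail D P p v : S D -> pd_coef D P p -> pd_tail D v ->
  pd_coef D P (p + v).
Proof.
move=> SD Dp Dv; have [k [g DE]] : has_tailcone (pd_tail D) (pd_coef D P).
  by apply: fan_tailcone => //; exists p.
by rewrite DE in Dp *; apply: (hull_plus_tail (fan_cone SD)).
Qed.

Lemma principal_tail D U u f P v : S D -> U `<=` Loc D -> U P ->
  principal_on D U h u f -> pd_tail D v -> ht v = pairing (toQ u) v.
Proof.
move=> SD UL UP [_ hE] Dv; have [p Dp] := UL P UP.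
rewrite -(support_tail SD Dp Dv) (hE P p UP Dp).
rewrite (hE P _ UP (coef_tail SD Dp Dv)) pairingDr; ring.
Qed.

Definition trivializes D U u f : Prop :=
  [/\ U `<=` Loc D /\ nonempty_open U, complete_locus (Loc D) -> U = Loc D &
      principal_on D U h u f].

(** If the locus is complete this is the Cartier condition.  Otherwise h_P is
    u + c with u and c integral; c is the order of a power of a uniformizer, and
    away from finitely many points Q the coefficient is the tailcone, h_Q is the
    linear part and that power is invertible. *)
Lemma locally_principal D P : S D -> Loc D P ->
  exists U u f, trivializes D U u f /\ U P.
Proof.
move=> SD LP; have [[hSF _ hfin] hC] := hh.
have [cD|ncD] := pselect (complete_locus (Loc D)).
  have [u [f uf]] := hC D SD cD; exists (Loc D), u, f.
  by split=> //; split=> //; split=> //; apply: fan_Loc_open.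
have [_ haff hint] := hSF P.
have [|k v Dv|u [c hE]] := @integral_affine r (pd_tail D) (pd_coef D P) (h P)
  (fan_cone SD) (fan_tailcone SD LP); first exact: haff.
- by apply: hint; exists D.
have [t tu] := curve_smooth P.
have tc0 : t ^ c != 0 by rewrite expfz_neq0 // (uniformizer_neq0 tu).
pose U := [set Q | Q = P \/ [/\ pd_coef D Q = pd_tail D,
  forall v, slice_support S Q v -> h Q v = ht v & ordP Q (t ^ c) = 0]].
exists U, u, (t ^ c); split; last by left.
split; [split|by []|split=> //].
- move=> Q [->//|[DQ _ _]]; exists 0; rewrite DQ; exact: cone0 (fan_cone SD).
- have [_ _ _ Dfin] := fan_polyDiv SD.
  have fin : finite_set ([set Q | pd_coef D Q <> pd_tail D] `|`
      [set Q | ~ forall v, slice_support S Q v -> h Q v = ht v] `|`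
      [set Q | ordP Q (t ^ c) <> 0]).
    by rewrite !finite_setU; do !split=> //; apply: finite_ordP_neq0.
  apply: sub_finite_set fin => Q /= nUQ; apply: contrapT.
  move=> /not_orP [/not_orP [/contrapT h1 /contrapT h2] /contrapT h3].
  by apply: nUQ; right.
move=> Q v [->|[DQ hQ oQ]] Dv; first by rewrite (ordP_uniformizerXz _ tu) hE.
rewrite oQ addr0 hQ; last by exists D.
have [p Dp] := LP; rewrite DQ in Dv.
rewrite -(support_tail SD Dp Dv) !hE ?pairingDr //; last exact: coef_tail.
ring.
Qed.

Lemma dual_cone_tail D U u u' f P : S D -> U `<=` Loc D -> U P ->
  principal_on D U h u' f ->
  dual_cone (pd_tail D) (toQ (u - u')) <->
  forall v, pd_tail D v -> ht v <= pairing (toQ u) v.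
Proof.
move=> SD UL UP hE; split=> hu v Dv.
  by rewrite (principal_tail SD UL UP hE Dv) -subr_ge0 -pairingBl -toQB; apply: hu.
by rewrite toQB pairingBl subr_ge0 -(principal_tail SD UL UP hE Dv); apply: hu.
Qed.

(** As h_P = u' + ord_P f' on the coefficient at P, the evaluation at u - u'
    plus the order of f / f' is the minimum of u - h_P plus the order of f. *)
Lemma Gamma_restr D U u u' f f' : S D -> U `<=` Loc D ->
  principal_on D U h u' f' -> f != 0 -> dual_cone (pd_tail D) (toQ (u - u')) ->
  Gamma (Loc (pdiv_restr D U))
    (fun P => (pdiv_eval (pdiv_restr D U) (toQ (u - u')) P)%:E) (f / f') <->
  forall P v, U P -> pd_coef D P v ->
    0 <= (ordP P f)%:~R + (pairing (toQ u) v - h P v).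
Proof.
move=> SD UL [f'0 hE] f0 udual.
have ord_eval P v : U P -> pd_coef D P v ->
    (ordP P (f / f'))%:~R + pairing (toQ (u - u')) v =
    (ordP P f)%:~R + (pairing (toQ u) v - h P v).
  move=> UP Dv; rewrite ordPM ?invr_eq0 // ordPV // (hE P v UP Dv) toQB pairingBl.
  rewrite rmorphB /=; ring.
have evalE P : U P -> exists2 v0, pd_coef D P v0 &
    pdiv_eval (pdiv_restr D U) (toQ (u - u')) P = pairing (toQ (u - u')) v0 /\
    forall v, pd_coef D P v ->
      pairing (toQ (u - u')) v0 <= pairing (toQ (u - u')) v.
  move=> UP; have [v0 [[Dv0 _] v0min]] := min_at_vertex (fan_cone SD)
    (fan_pointed SD) (fan_tailcone SD (UL P UP)) udual.
  exists v0 => //; split=> //; apply: minvalE; first by exists v0.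
  by move=> _ [v [_ /v0min le] <-].
split=> [[e0|G] P v UP Dv|pos]; last right => P [_ [UP _]].
- by move/eqP: e0; rewrite mulf_eq0 invr_eq0 (negPf f0) (negPf f'0).
- have [v0 Dv0 [eE v0min]] := evalE P UP.
  have /G : Loc (pdiv_restr D U) P by exists v.
  rewrite eE -EFinD lee_fin -(ord_eval P v) // => /le_trans; apply.
  by rewrite lerD2l v0min.
have [v0 Dv0 [eE _]] := evalE P UP.
by rewrite eE -EFinD lee_fin ord_eval // pos.
Qed.

(** Read in a trivialization of h, the condition that f chi^u be a section no
    longer involves that trivialization; the trivializing open sets, being
    nonempty, then cover all tailcones and all points of the slices. *)
Lemma L_nonzero u f : f != 0 -> L_ S h u f <->
  Box S ht (toQ u) /\ forall D P v, S D -> pd_coef D P v ->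
    0 <= (ordP P f)%:~R + (pairing (toQ u) v - h P v).
Proof.
move=> f0.
have grade f' u' : f' != 0 -> constX r f * chi Y u * ((constX r f')^-1 * chi Y (- u'))
    = constX r (f / f') * chi Y (u - u').
  by move=> f'0; rewrite constX_div // chiD mulrACA.
have homog D U u' f' : f' != 0 ->
    ringX (pdiv_restr D U) (constX r (f / f') * chi Y (u - u')) <->
    dual_cone (pd_tail D) (toQ (u - u')) /\
    Gamma (Loc (pdiv_restr D U))
      (fun P => (pdiv_eval (pdiv_restr D U) (toQ (u - u')) P)%:E) (f / f').
  by move=> f'0; apply: ringX_homogeneous; rewrite mulf_neq0 ?invr_eq0.
split=> [Lf|[ubox pos] A e [D [U [u' [f' [SD ULo Uc hE [-> ->]]]]]]].
  have sec D U u' f' : S D -> trivializes D U u' f' ->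
      dual_cone (pd_tail D) (toQ (u - u')) /\
      Gamma (Loc (pdiv_restr D U))
        (fun P => (pdiv_eval (pdiv_restr D U) (toQ (u - u')) P)%:E) (f / f').
    move=> SD [ULo Uc hE]; have f'0 := hE.1.
    apply/(homog D U u' f' f'0); rewrite -grade //; apply: Lf.
    by exists D, U, u', f'.
  split=> [v [D SD Dv]|D P v SD Dv].
    have [P LP] := nonempty_open_neq0 (fan_Loc_open SD).
    have [U [u' [f' [tr UP]]]] := locally_principal SD LP.
    have [udual _] := sec D U u' f' SD tr; have [[UL _] _ hE] := tr.
    exact: (dual_cone_tail u SD UL UP hE).1 udual v Dv.
  have [|U [u' [f' [tr UP]]]] := @locally_principal D P SD; first by exists v.
  have [udual G] := sec D U u' f' SD tr; have [[UL _] _ hE] := tr.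
  exact: (Gamma_restr SD UL hE f0 udual).1 G P v UP Dv.
have [UL Uo] := ULo; have [P UP] := nonempty_open_neq0 Uo.
have udual : dual_cone (pd_tail D) (toQ (u - u')).
  by apply/(dual_cone_tail u SD UL UP hE) => v Dv; apply: ubox; exists D.
rewrite grade ?hE.1 //; apply/homog; [exact: hE.1|split=> //].
by apply/(Gamma_restr SD UL hE f0 udual) => Q v _; apply: pos.
Qed.

Lemma vertex_min u D P : Box S ht (toQ u) -> S D -> Loc D P ->
  exists v, is_vertex (pd_coef D P) v /\ forall x, pd_coef D P x ->
    pairing (toQ u) v - h P v <= pairing (toQ u) x - h P x.
Proof.
move=> ubox SD LP; have [[hSF _ _] _] := hh; have [_ haff _] := hSF P.
have [a [c hE]] := haff D SD; have [p Dp] := LP.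
have [s Ds|v [vv vmin]] := @min_at_vertex r (pd_tail D) (fan_cone SD)
  (fan_pointed SD) (pd_coef D P) (toQ u - a) (fan_tailcone SD LP).
  rewrite pairingBl subr_ge0; have <- : ht s = pairing a s.
    by rewrite -(support_tail SD Dp Ds) !hE ?pairingDr //; [ring|apply: coef_tail].
  by apply: ubox; exists D.
exists v; split=> // x Dx; have [Dv _] := vv.
by have := vmin x Dx; rewrite !pairingBl (hE _ Dv) (hE _ Dx) !opprD !addrA lerD2r.
Qed.

(** The slice at P is a finite union of polyhedra, on each of which u - h_P is
    smallest at a vertex. *)
Lemma hstarE u P : Box S ht (toQ u) ->
  (hstar S h (toQ u) P = +oo%E /\ forall D, S D -> pd_coef D P = set0) \/
  exists D v, [/\ S D, pd_coef D P v,
    hstar S h (toQ u) P = (pairing (toQ u) v - h P v)%:E &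
    forall D' x, S D' -> pd_coef D' P x ->
      pairing (toQ u) v - h P v <= pairing (toQ u) x - h P x].
Proof.
move=> ubox; pose A := [set D | S D /\ Loc D P].
have finA : finite_set A.
  by case: fanS => finS _ _; apply: sub_finite_set finS => D [].
have /choice [w wP] : forall D, exists v, A D ->
    is_vertex (pd_coef D P) v /\ forall x, pd_coef D P x ->
    pairing (toQ u) v - h P v <= pairing (toQ u) x - h P x.
  move=> D; have [[SD LD]|nA] := pselect (A D); last by exists 0.
  by have [v hv] := vertex_min ubox SD LD; exists v.
rewrite /hstar; have [A0|/set0P A0] := eqVneq A set0; last right.
  left; have D0 D : S D -> pd_coef D P = set0.
    move=> SD; apply/seteqP; split=> // x Dx.
    by have : A D by [split=> //; exists x]; rewrite A0.
  have V0 : slice_vertices S P = set0.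
    by apply/seteqP; split=> // v [D SD [+ _]]; rewrite D0.
  by split=> //; rewrite V0; case: asboolP => // -[].
have [D AD Dmin] := finite_argmin (fun D => pairing (toQ u) (w D) - h P (w D)) finA A0.
have [[SD LD] [vw _]] := (AD, wP D AD); have [Dw _] := vw.
have wmin D' x : S D' -> pd_coef D' P x ->
    pairing (toQ u) (w D) - h P (w D) <= pairing (toQ u) x - h P x.
  move=> SD' Dx; have AD' : A D' by split=> //; exists x.
  exact: le_trans (Dmin D' AD') ((wP D' AD').2 x Dx).
exists D, (w D); split=> //; case: asboolP => [_|[]]; last by exists (w D), D.
congr (_%:E); apply: minvalE; first by exists (w D) => //; exists D.
by move=> _ [v [D' SD' [Dv _]] <-]; apply: wmin Dv.
Qed.

End Sections.

Theorem proposition3p23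
  (K : closedFieldType) (charK : [pchar K]%R =i pred0)
  (Y : smoothProjCurve K) (r : nat) (S : set (polyDiv Y r))
  (fanS : divisorial_fan S)
  (h : closed_point Y -> 'rV[rat]_r -> rat) (ht : 'rV[rat]_r -> rat)
  (hh : CaSF S h ht) :
  (forall u : 'rV[int]_r,
     (exists2 f : pv_field Y, L_ S h u f & f <> 0%R) -> Box S ht (toQ u)) /\
  (forall u : 'rV[int]_r,
     Box S ht (toQ u) -> L_ S h u = Gamma setT (hstar S h (toQ u))).
Proof.
split=> [u [f Lf /eqP f0]|u ubox].
  exact: ((L_nonzero fanS hh u f0).1 Lf).1.
apply/seteqP; split=> f.
  have [->|f0] := eqVneq f 0%R; first by left.
  move=> /(L_nonzero fanS hh u f0) [_ pos]; right=> P _.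
  have [[-> _]|[D [v [SD Dv -> _]]]] := hstarE fanS hh P ubox.
    by rewrite addey.
  by rewrite -EFinD lee_fin (pos D).
have [-> _|f0] := eqVneq f 0%R.
  move=> A e [D [U [u' [f' [_ _ _ _ [-> _]]]]]]; rewrite constX0 !mul0r; exists [::].
  by rewrite big_nil; split.
move=> [/eqP|G]; first by rewrite (negPf f0).
apply/(L_nonzero fanS hh u f0); split=> // D P v SD Dv.
have := G P I; have [[_ D0]|[D' [w [_ _ -> wmin]]]] :=
  hstarE fanS hh P ubox.
  by rewrite (D0 D SD) in Dv.
rewrite -EFinD lee_fin => /le_trans; apply.
by rewrite lerD2l; apply: (wmin D).
Qed.
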